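(* Let $\mu^\vee\in P^\vee$ be an antidominant coweight and set $W_{\mu^\vee}=\langle s_{\alpha_i}\mid i\in[1,r],\ \langle\alpha_i,\mu^\vee\rangle=0\rangle=\{w\in W\mid w(\mu^\vee)=\mu^\vee\}$. Then $$j^{\mathrm{ad}}(\xi_{t_{\mu^\vee}})=\sum_{w\in W/W_{\mu^\vee}}\widetilde A_{t_{w(\mu^\vee)}}.$$
   Context: Let $\mathfrak g$ be a simple complex Lie algebra with root system $R$, simple roots $\alpha_1,\dots,\alpha_r$, highest root $\Theta$, Weyl group $W$, weight lattice $P$, coroot and coweight lattices $Q^\vee\subset P^\vee$, and $S=\mathrm{Sym}(P)$. Extended affine Weyl group: $\widetilde W_{\rm aff}=P^\vee\rtimes W\supset W_{\rm aff}=Q^\vee\rtimes W$, with $t_{\lambda^\vee}$ the translation by $\lambda^\vee$. $W_{\rm aff}$ is a Coxeter group with generators $s_1,\dots,s_r$ and $s_0=t_{\Theta^\vee}s_\Theta$. With $\alpha_0=\epsilon-\Theta$ ($\epsilon$ the null root) and the action $wt_{\lambda^\vee}\cdot(\mu+n\epsilon)=w(\mu)+(n-\langle\mu,\lambda^\vee\rangle)\epsilon$, let $Z\subset\widetilde W_{\rm aff}$ be the subgroup of elements permuting $\{\alpha_0,\dots,\alpha_r\}$ (equivalently, stabilising the fundamental alcove); $Z\simeq P^\vee/Q^\vee$. Every $x\in\widetilde W_{\rm aff}$ is uniquely $x=\tau\widehat x$ with $\tau\in Z$, $\widehat x\in W_{\rm aff}$, and $\ell(x):=\ell(\widehat x)$.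 $\widetilde W_{\rm aff}^-$ is the set of minimal length representatives of $\widetilde W_{\rm aff}/W$. For antidominant $\mu^\vee$ one has $t_{\mu^\vee}\in\widetilde W^-_{\rm aff}$. Extended nil-Hecke ring: $\widetilde W_{\rm aff}$ acts on $S$ by $(wt_{\lambda^\vee})(s)=w(s)$. Let $\widetilde Q_{\rm aff}=\bigoplus_{w\in\widetilde W_{\rm aff}}\mathrm{Frac}(S)\,\delta_w$ with $\delta_u\delta_v=\delta_{uv}$, $\delta_us=u(s)\delta_u$. Put $A_i=\frac1{\alpha_i}(\delta_e-\delta_{s_i})$ for $1\le i\le r$, $A_0=\frac{-1}{\Theta}(\delta_e-\delta_{s_0})$, $A_w=A_{i_1}\cdots A_{i_\ell}$ for a reduced expression $w=s_{i_1}\cdots s_{i_\ell}\in W_{\rm aff}$, and $\widetilde A_x=\delta_\tau A_{\widehat x}$ for $x=\tau\widehat x$. Then $\widetilde{\mathbb A}_{\rm aff}=\bigoplus_{x\in\widetilde W_{\rm aff}}S\,\widetilde A_x$ is a subring of $\widetilde Q_{\rm aff}$, and $Z_{\widetilde{\mathbb A}_{\rm aff}}(S)$ denotes the centralizer of $S$ in it. The map $j^{\rm ad}$: let $\Omega K^{\rm ad}$ be the adjoint affine Grassmannian (based loops in a maximal compact subgroup $K^{\rm ad}$ of the adjoint group of $\mathfrak g$). Its $T$-equivariant homology $H_*^T(\Omega K^{\rm ad})$ is a free $S$-module with Schubert basis $(\xi_x)_{x\in\widetilde W^-_{\rm aff}}$ (also written $\widetilde\xi_x$), and $j^{\rm ad}:H_*^T(\Omega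 K^{\rm ad})\to Z_{\widetilde{\mathbb A}_{\rm aff}}(S)$ is the $S$-algebra isomorphism for which $j^{\rm ad}(\xi_x)$ is characterized as the unique element of $Z_{\widetilde{\mathbb A}_{\rm aff}}(S)$ congruent to $\widetilde A_x$ modulo $\sum_{y\in W\setminus\{e\}}\widetilde{\mathbb A}_{\rm aff}A_y$ (existence and uniqueness are known). *)

(* Defs.v *)
From HB Require Import structures.
From mathcomp Require Import all_boot all_order all_fingroup all_algebra finmap.
From mathcomp Require Import boolp classical_sets.
From mathcomp Require Import mpoly.
From mathcomp Require Import monalg.

Set Implicit Arguments.
Unset Strict Implicit.
Unset Printing Implicit Defensive.

Import Order.TTheory GRing.Theory Num.Theory.
Local Open Scope ring_scope.
Local Open Scope quotient_scope.

Local Notation mcoeff := monalg.mcoeff.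
Local Notation msupp := monalg.msupp.
Local Notation "g @_ k" := (monalg.mcoeff k g) : ring_scope.

(* The crossed product of a group G acting on a commutative ring F: finitely   *)
(* supported sums of f delta_x, with delta_x f = x(f) delta_x.                 *)
Section CrossedProduct.
Variables (G : groupType) (F : comNzRingType) (act : G -> {rmorphism F -> F}).
Hypothesis act1 : forall f, act 1%g f = f.
Hypothesis actM : forall x y f, act (x * y)%g f = act x (act y f).
Implicit Types (g : {malg F[G]}).

Definition crossed_one : {malg F[G]} := << 1 *g 1%g >>.
Definition crossed_mul g1 g2 : {malg F[G]} :=
  \sum_(x <- msupp g1) \sum_(y <- msupp g2)
    << g1@_x * act x g2@_y *g (x * y)%g >>.

Local Open Scope fset_scope.

Lemma crossed_mulEw (d1 d2 : {fset G}) g1 g2 :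
  msupp g1 `<=` d1 -> msupp g2 `<=` d2 -> crossed_mul g1 g2 =
  \sum_(x <- d1) \sum_(y <- d2) << g1@_x * act x g2@_y *g (x * y)%g >>.
Proof.
move=> le_d1 le_d2; rewrite /crossed_mul (big_fset_incl _ le_d1) /=.
  apply/eq_bigr=> x _; apply/big_fset_incl => // y _ /mcoeff_outdom ->.
  by rewrite rmorph0 mulr0 monalgU0.
move=> x _ /mcoeff_outdom g1x.
by rewrite big1 => // y _; rewrite g1x mul0r monalgU0.
Qed.

Lemma crossed_mulDl : left_distributive crossed_mul +%R.
Proof.
move=> g1 g2 g; rewrite (@crossed_mulEw (msupp g1 `|` msupp g2) (msupp g) (g1 + g2))
  ?msuppD_le ?fsubset_refl //.
rewrite (@crossed_mulEw (msupp g1 `|` msupp g2) (msupp g) g1)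
  ?fsubsetUl ?fsubset_refl //.
rewrite (@crossed_mulEw (msupp g1 `|` msupp g2) (msupp g) g2)
  ?fsubsetUr ?fsubset_refl //.
rewrite -big_split /=; apply/eq_bigr=> x _.
rewrite -big_split /=; apply/eq_bigr=> y _.
by rewrite mcoeffD mulrDl monalgUD.
Qed.

Lemma crossed_mulDr : right_distributive crossed_mul +%R.
Proof.
move=> g g1 g2; rewrite (@crossed_mulEw (msupp g) (msupp g1 `|` msupp g2) g (g1 + g2))
  ?msuppD_le ?fsubset_refl //.
rewrite (@crossed_mulEw (msupp g) (msupp g1 `|` msupp g2) g g1)
  ?fsubsetUl ?fsubset_refl //.
rewrite (@crossed_mulEw (msupp g) (msupp g1 `|` msupp g2) g g2)
  ?fsubsetUr ?fsubset_refl //.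
rewrite -big_split /=; apply/eq_bigr=> x _.
rewrite -big_split /=; apply/eq_bigr=> y _.
by rewrite mcoeffD rmorphD mulrDr monalgUD.
Qed.

Lemma crossed_mul0l g : crossed_mul 0 g = 0.
Proof. by rewrite /crossed_mul msupp0 big_seq_fset0. Qed.

Lemma crossed_mul0r g : crossed_mul g 0 = 0.
Proof. by rewrite /crossed_mul msupp0 big1 // => x _; rewrite big_seq_fset0. Qed.

Lemma crossed_mulUU c1 c2 x y :
  crossed_mul << c1 *g x >> << c2 *g y >> = << c1 * act x c2 *g (x * y)%g >>.
Proof. by rewrite (crossed_mulEw msuppU_le msuppU_le) !big_seq_fset1 !mcoeffUU. Qed.

Lemma crossed_mul_suml (I : Type) (s : seq I) (f : I -> {malg F[G]}) g :
  crossed_mul (\sum_(i <- s) f i) g = \sum_(i <- s) crossed_mul (f i) g.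
Proof.
exact: (big_morph (crossed_mul^~ g) (fun a b => crossed_mulDl a b g)
          (crossed_mul0l g)).
Qed.

Lemma crossed_mul_sumr (I : Type) (s : seq I) (f : I -> {malg F[G]}) g :
  crossed_mul g (\sum_(i <- s) f i) = \sum_(i <- s) crossed_mul g (f i).
Proof. exact: (big_morph _ (crossed_mulDr g) (crossed_mul0r g)). Qed.

Lemma crossed_mul1l : left_id crossed_one crossed_mul.
Proof.
move=> g; rewrite [g in LHS]monalgE crossed_mul_sumr [RHS]monalgE.
by apply: eq_bigr => x _; rewrite crossed_mulUU act1 mul1r mul1g.
Qed.

Lemma crossed_mul1r : right_id crossed_one crossed_mul.
Proof.
move=> g; rewrite [g in LHS]monalgE crossed_mul_suml [RHS]monalgE.
by apply: eq_bigr => x _; rewrite crossed_mulUU rmorph1 mulr1 mulg1.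
Qed.

Lemma crossed_mulA : associative crossed_mul.
Proof.
move=> g1 g2 g3; rewrite [g1]monalgE !crossed_mul_suml; apply: eq_bigr => x _.
rewrite [g2]monalgE !(crossed_mul_suml, crossed_mul_sumr).
apply: eq_bigr => y _.
rewrite [g3]monalgE !crossed_mul_sumr; apply: eq_bigr => z _.
by rewrite !crossed_mulUU rmorphM actM mulrA mulgA.
Qed.

Lemma crossed_one_neq0 : crossed_one != 0.
Proof. by apply/eqP/malgP=> /(_ 1%g) /eqP; rewrite !mcoeffsE oner_eq0. Qed.

End CrossedProduct.

(* The extension of an injective ring morphism to the field of fractions. *)
Section FracMap.
Variables (R : idomainType) (f : {rmorphism R -> R}).
Hypothesis f_inj : injective f.
Local Notation tofrac := (@FracField.tofrac R).
Local Notation qrepr := generic_quotient.repr.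

Definition fracmap (x : {fraction R}) : {fraction R} :=
  tofrac (f \n_(qrepr x)) / tofrac (f \d_(qrepr x)).

Lemma pi_ratioM (y : {ratio R}) :
  \pi_({fraction R}) y * tofrac \d_y = tofrac \n_y.
Proof.
unlock FracField.tofrac; rewrite -[LHS]FracField.pi_mul.
apply/eqP; rewrite FracField.equivf_def /FracField.mulf.
by rewrite !numden_Ratio ?oner_neq0 ?mulf_neq0 ?denom_ratioP ?oner_neq0 // !mulr1 mulrC.
Qed.

Lemma frac_repr (x : {fraction R}) :
  x = tofrac \n_(qrepr x) / tofrac \d_(qrepr x).
Proof.
have nz : tofrac \d_(qrepr x) != 0 by rewrite tofrac_eq0 denom_ratioP.
apply: (mulIf nz); rewrite divfK // -[RHS]pi_ratioM.
by rewrite generic_quotient.reprK.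
Qed.

Lemma fmorph_neq0 a : a != 0 -> f a != 0.
Proof. by apply: contra_neq => fa; apply: f_inj; rewrite rmorph0. Qed.

Lemma fracmap_div (n d : R) : d != 0 ->
  fracmap (tofrac n / tofrac d) = tofrac (f n) / tofrac (f d).
Proof.
move=> d0; set x := (_ / _ : {fraction R}).
have nz y : \d_(qrepr y : ratio R) != 0 by rewrite denom_ratioP.
have : x == x by []; rewrite {2}[x]frac_repr {1}/x.
rewrite eqr_div ?tofrac_eq0 ?nz // -!tofracM tofrac_eq => /eqP /(congr1 f).
rewrite !rmorphM => /(congr1 tofrac); rewrite !tofracM => /eqP.
rewrite -eqr_div ?tofrac_eq0 ?fmorph_neq0 ?nz // => /eqP ->.
by [].
Qed.

Lemma fracmap_tofrac n : fracmap (tofrac n) = tofrac (f n).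
Proof. by have := @fracmap_div n 1 (oner_neq0 _); rewrite !rmorph1 !divr1. Qed.

Lemma fracmap_zmod : zmod_morphism fracmap.
Proof.
move=> x y; have nz (z : {fraction R}) : \d_(qrepr z) != 0 by rewrite denom_ratioP.
rewrite {1}[x]frac_repr {1}[y]frac_repr -mulNr addf_div ?tofrac_eq0 ?nz //.
rewrite -tofracN -!tofracM -tofracD fracmap_div ?mulf_neq0 ?nz //.
rewrite rmorphD !rmorphM rmorphN !(tofracD, tofracM, tofracN) /fracmap.
by rewrite -mulNr addf_div ?tofrac_eq0 ?fmorph_neq0 ?nz.
Qed.

Lemma fracmap_monoid : monoid_morphism fracmap.
Proof.
split=> [|x y]; first by rewrite -[1]/(tofrac 1) fracmap_tofrac rmorph1.
have nz (z : {fraction R}) : \d_(qrepr z) != 0 by rewrite denom_ratioP.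
rewrite {1}[x]frac_repr {1}[y]frac_repr mulf_div -!tofracM.
rewrite fracmap_div ?mulf_neq0 ?nz // !rmorphM.
by rewrite /fracmap mulf_div.
Qed.
End FracMap.

(* V = Q^r (columns) is the rational span of the roots, its dual is made of    *)
(* rows, and endomorphisms of V are matrices acting on the left of columns.    *)
Definition pairing r (l : 'rV[rat]_r) (v : 'cV[rat]_r) : rat := (l *m v) 0 0.

(* The root systems of simple complex Lie algebras of rank r, i.e. irreducible *)
(* reduced crystallographic ones, with a chosen base and the highest root.     *)
(* The values of coroot off the roots are irrelevant; on the roots they are    *)
(* determined by the axioms.                                                   *)
Record root_system (r : nat) := RootSystem {
  roots : seq 'cV[rat]_r;
  coroot : 'cV[rat]_r -> 'rV[rat]_r;
  alpha : 'I_r -> 'cV[rat]_r;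
  Theta : 'cV[rat]_r;
  roots_nonempty : roots != [::];
  roots_neq0 : 0 \notin roots;
  roots_span : (<<roots>> = fullv)%VS;
  coroot_root : forall a, a \in roots -> pairing (coroot a) a = 2;
  roots_reflection : forall a b, a \in roots -> b \in roots ->
    b - pairing (coroot a) b *: a \in roots;
  roots_integral : forall a b, a \in roots -> b \in roots ->
    pairing (coroot a) b \is a Num.int;
  roots_reduced : forall a (c : rat), a \in roots -> c *: a \in roots ->
    c = 1 \/ c = -1;
  roots_irreducible : forall A : pred 'cV[rat]_r,
    (exists2 a, a \in roots & A a) -> (exists2 b, b \in roots & ~~ A b) ->
    exists a b, [/\ a \in roots, b \in roots, A a, ~~ A b
                  & pairing (coroot b) a != 0];
  alpha_root : forall i, alpha i \in roots;
  alpha_basis : basis_of fullv [seq alpha i | i <- enum 'I_r];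
  alpha_base : forall a, a \in roots -> exists c : 'I_r -> nat,
    a = \sum_i (c i)%:R *: alpha i \/ a = - \sum_i (c i)%:R *: alpha i;
  Theta_root : Theta \in roots;
  Theta_highest : forall a, a \in roots -> exists c : 'I_r -> nat,
    Theta - a = \sum_i (c i)%:R *: alpha i
}.

Section RootSystem.
Variables (r : nat) (D : root_system r).

Local Notation V := 'cV[rat]_r.

Definition refl_mx (a : V) : 'M[rat]_r := 1%:M - a *m coroot D a.

Definition in_weyl (w : 'M[rat]_r) : Prop :=
  exists2 s : seq V, {subset s <= roots D}
                   & w = \prod_(a <- s) refl_mx a.

Record weyl := Weyl { weyl_mx :> 'M[rat]_r; _ : `[< in_weyl weyl_mx >] }.
HB.instance Definition _ := [isSub for weyl_mx].
HB.instance Definition _ := [Countable of weyl by <:].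

Lemma weylP (w : weyl) : in_weyl w.
Proof. by apply/asboolP; case: w. Qed.

Lemma refl_mxE a (v : V) : refl_mx a *m v = v - pairing (coroot D a) v *: a.
Proof.
rewrite /refl_mx mulmxBl mul1mx -mulmxA; congr (_ - _).
apply/matrixP => i j; rewrite !mxE big_ord1 mulrC !ord1 /pairing.
by congr (_ * _); rewrite !mxE.
Qed.

Lemma refl_mxK a : a \in roots D -> refl_mx a *m refl_mx a = 1%:M.
Proof.
move=> Ra.
have E : coroot D a *m a = 2%:M.
  apply/matrixP => i j; rewrite !ord1 !mxE /=.
  by have := coroot_root Ra; rewrite /pairing mxE => ->.
rewrite /refl_mx mulmxBl mul1mx mulmxBr mulmx1 mulmxA -[a *m _ *m a]mulmxA E.
by rewrite mul_mx_scalar -scalemxAl scaler_nat mulr2n opprB addrK subrK.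
Qed.

Lemma in_weyl1 : in_weyl 1%:M.
Proof. by exists [::]; rewrite ?big_nil. Qed.

Lemma in_weylM u w : in_weyl u -> in_weyl w -> in_weyl (u *m w).
Proof.
move=> [s hs ->] [t ht ->]; exists (s ++ t); last by rewrite big_cat.
by move=> x; rewrite mem_cat => /orP[/hs|/ht].
Qed.

Lemma in_weyl_refl a : a \in roots D -> in_weyl (refl_mx a).
Proof. by exists [:: a]; rewrite ?big_seq1 // => x; rewrite inE => /eqP ->. Qed.

Lemma in_weylV w : in_weyl w -> exists2 u, in_weyl u & u *m w = 1%:M.
Proof.
move=> [s hs ->]; elim: s hs => [|a s IH] hs.
  by exists 1%:M; rewrite ?big_nil ?mulmx1 //; exact: in_weyl1.
have [|u Wu uE] := IH; first by move=> x xs; apply: hs; rewrite inE xs orbT.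
have Ra : a \in roots D by apply: hs; rewrite inE eqxx.
exists (u *m refl_mx a); first exact/in_weylM/in_weyl_refl.
by rewrite big_cons mulmxA -[_ *m refl_mx a]mulmxA refl_mxK // mulmx1.
Qed.

Lemma weyl_unit (w : weyl) : weyl_mx w \in unitmx.
Proof. by have [u _ /mulmx1_unit[]] := in_weylV (weylP w). Qed.

Lemma in_weyl_inv (w : weyl) : in_weyl (invmx w).
Proof.
have [u Wu uE] := in_weylV (weylP w).
by rewrite -[invmx _]mul1mx -uE mulmxK // weyl_unit.
Qed.

Definition weyl_one : weyl := Weyl (asboolT in_weyl1).
Definition weyl_mul (u w : weyl) : weyl :=
  Weyl (asboolT (in_weylM (weylP u) (weylP w))).
Definition weyl_inv (w : weyl) : weyl := Weyl (asboolT (in_weyl_inv w)).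

Lemma weyl_mulA : associative weyl_mul.
Proof. by move=> u v w; apply/val_inj; rewrite /= mulmxA. Qed.
Lemma weyl_mul1 : left_id weyl_one weyl_mul.
Proof. by move=> w; apply/val_inj; rewrite /= mul1mx. Qed.
Lemma weyl_mulV : left_inverse weyl_one weyl_inv weyl_mul.
Proof. by move=> w; apply/val_inj; rewrite /= mulVmx // weyl_unit. Qed.

Lemma weyl_roots (w : weyl) a : a \in roots D -> weyl_mx w *m a \in roots D.
Proof.
have [s hs ->] := weylP w; elim: s hs => [|b s IH] hs Ra.
  by rewrite big_nil mul1mx.
rewrite big_cons -mulmxA refl_mxE roots_reflection //.
  by apply: hs; rewrite inE eqxx.
by apply: IH => // x xs; apply: hs; rewrite inE xs orbT.
Qed.

(* W is finite, since it acts faithfully on the finite set of roots. *)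
Definition weyl_perm (w : weyl) : {ffun seq_sub (roots D) -> seq_sub (roots D)} :=
  [ffun a => SeqSub (weyl_roots w (valP a))].

Lemma weyl_perm_inj : injective weyl_perm.
Proof.
move=> u w /ffunP E; apply/val_inj => /=.
suff H (v : V) : weyl_mx u *m v = weyl_mx w *m v.
  apply/matrixP => i j; have := H (delta_mx j 0).
  by rewrite -!colE => /matrixP/(_ i 0); rewrite !mxE.
have : v \in <<roots D>>%VS by rewrite roots_span memvf.
move/(@coord_span _ _ _ (in_tuple (roots D))) => ->.
rewrite !mulmx_sumr; apply: eq_bigr => i _; rewrite -!scalemxAr; congr (_ *: _).
have Ri : (in_tuple (roots D))`_i \in roots D by rewrite mem_nth.
by have := E (SeqSub Ri); rewrite !ffunE => /(congr1 val).
Qed.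

Definition weyl_of_perm f : option weyl :=
  xget None (fun o => if o is Some w then weyl_perm w = f else False).

Lemma weyl_permK : pcancel weyl_perm weyl_of_perm.
Proof.
move=> w; rewrite /weyl_of_perm; case: xgetP => [[u|] _ //= E|].
  by congr Some; apply: weyl_perm_inj.
by move=> /(_ (Some w)) [].
Qed.

HB.instance Definition _ : isFinite weyl := PCanIsFinite weyl_permK.
HB.instance Definition _ :=
  Finite_isGroup.Build weyl weyl_mulA weyl_mul1 weyl_mulV.

Definition wrefl a (Ra : a \in roots D) : weyl := Weyl (asboolT (in_weyl_refl Ra)).

Definition in_coweight : pred 'rV[rat]_r :=
  fun l => all (fun a => pairing l a \is a Num.int) (roots D).

Lemma in_coweight_zmod : zmod_closed in_coweight.
Proof.
split=> [|l m /allP Hl /allP Hm]; apply/allP => a Ra.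
  by rewrite /pairing mul0mx mxE rpred0.
have := rpredB (Hl a Ra) (Hm a Ra).
by rewrite /pairing mulmxBl [(_ - _ : 'M__) _ _]mxE [in X in _ -> _ + X \in _]mxE.
Qed.
HB.instance Definition _ := GRing.isZmodClosed.Build _ in_coweight in_coweight_zmod.

Record coweight := Coweight { coweight_row :> 'rV[rat]_r; _ : in_coweight coweight_row }.
HB.instance Definition _ := [isSub for coweight_row].
HB.instance Definition _ := [Choice of coweight by <:].
HB.instance Definition _ := [SubChoice_isSubZmodule of coweight by <:].


Definition ccoroot_subproof a : a \in roots D -> in_coweight (coroot D a).
Proof. by move=> Ra; apply/allP => b; apply: roots_integral. Qed.

Definition ccoroot a (Ra : a \in roots D) : coweight :=
  Coweight (ccoroot_subproof Ra).

Lemma wact_subproof (w : weyl) (l : coweight) : in_coweight (l *m invmx w).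
Proof.
apply/allP => a Ra; rewrite /pairing -mulmxA.
have /allP := valP l; apply; exact: (weyl_roots (w^-1)%g Ra).
Qed.

Definition wact (w : weyl) (l : coweight) : coweight :=
  Coweight (wact_subproof w l).

Lemma wact1 l : wact 1%g l = l.
Proof. by apply: val_inj; rewrite /= invmx1 mulmx1. Qed.

Lemma wactM u w l : wact (u * w)%g l = wact u (wact w l).
Proof.
apply: val_inj; have /(congr1 weyl_mx) /= E := invMg u w.
by rewrite /= E mulmxA.
Qed.

Lemma wactD w : {morph wact w : l m / l + m}.
Proof. by move=> l m; apply: val_inj; rewrite /= mulmxDl. Qed.

(* P^vee >| W: the pair (l, w) stands for t_l w. *)
Record extaff := ExtAff { trans_part : coweight; weyl_part : weyl }.

Definition extaff_pair (x : extaff) := (trans_part x, weyl_part x).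
Definition pair_extaff p := ExtAff p.1 p.2.
Lemma extaff_pairK : cancel extaff_pair pair_extaff.
Proof. by case. Qed.
HB.instance Definition _ := Choice.copy extaff (can_type extaff_pairK).

Definition extaff_one := ExtAff 0 1%g.
Definition extaff_mul x y :=
  ExtAff (trans_part x + wact (weyl_part x) (trans_part y))
         (weyl_part x * weyl_part y)%g.
Definition extaff_inv x :=
  ExtAff (- wact (weyl_part x)^-1%g (trans_part x)) (weyl_part x)^-1%g.

Lemma wactN w : {morph wact w : l / - l}.
Proof. by move=> l; apply: val_inj; rewrite /= mulNmx. Qed.

Lemma wact0 w : wact w 0 = 0.
Proof. by apply: val_inj; rewrite /= mul0mx. Qed.

Lemma extaff_mulA : associative extaff_mul.
Proof.
by move=> x y z; rewrite /extaff_mul /= wactD wactM addrA mulgA.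
Qed.

Lemma extaff_mul1 : left_id extaff_one extaff_mul.
Proof. by case=> l w; rewrite /extaff_mul /= wact1 add0r mul1g. Qed.

Lemma extaff_mulr1 : right_id extaff_one extaff_mul.
Proof. by case=> l w; rewrite /extaff_mul /= wact0 addr0 mulg1. Qed.

Lemma extaff_mulV : left_inverse extaff_one extaff_inv extaff_mul.
Proof. by case=> l w; rewrite /extaff_mul /= addNr mulVg. Qed.

Lemma extaff_mulVr : right_inverse extaff_one extaff_inv extaff_mul.
Proof.
by case=> l w; rewrite /extaff_mul /= wactN -wactM mulgV wact1 subrr.
Qed.

HB.instance Definition _ := isGroup.Build extaff
  extaff_mulA extaff_mul1 extaff_mulr1 extaff_mulV extaff_mulVr.

Definition transl (l : coweight) : extaff := ExtAff l 1%g.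
Definition of_weyl (w : weyl) : extaff := ExtAff 0 w.

(* The action on V + Q eps: t_l w (mu + n eps) = w mu + (n - <w mu, l>) eps. *)
Definition aff_act (x : extaff) (mun : V * rat) : V * rat :=
  (weyl_part x *m mun.1, mun.2 - pairing (trans_part x) (weyl_part x *m mun.1)).

(* Index 0 is the affine node, index lift ord0 i the i-th node of the base. *)
Definition aff_alpha (i : 'I_r.+1) : V * rat :=
  if unlift ord0 i is Some j then (alpha D j, 0) else (- Theta D, 1).

Definition aff_refl (i : 'I_r.+1) : extaff :=
  if unlift ord0 i is Some j then of_weyl (wrefl (alpha_root D j))
  else (transl (ccoroot (Theta_root D)) * of_weyl (wrefl (Theta_root D)))%g.

Definition in_Z (x : extaff) : Prop :=
  exists s : {perm 'I_r.+1}, forall i, aff_act x (aff_alpha i) = aff_alpha (s i).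

Definition in_coroot_lattice (l : 'rV[rat]_r) : Prop :=
  exists c : 'cV[rat]_r -> int, l = \sum_(a <- roots D) coroot D a *~ c a.

Definition in_Waff (x : extaff) : Prop := in_coroot_lattice (trans_part x).

Definition word_prod (s : seq 'I_r.+1) : extaff := (\prod_(i <- s) aff_refl i)%g.

Definition reduced (x : extaff) (s : seq 'I_r.+1) : Prop :=
  word_prod s = x /\ forall s', word_prod s' = x -> (size s <= size s')%N.

(* For x in W_aff, some reduced expression (by the braid relations, the choice *)
(* does not affect Adem below).                                                *)
Definition redword (x : extaff) : seq 'I_r.+1 := xget [::] (reduced x).

(* The (unique) decomposition x = tau xhat with tau in Z and xhat in W_aff. *)
Definition Zdecomp (x : extaff) : extaff * extaff :=
  xget (1%g, 1%g) (fun p => [/\ in_Z p.1, in_Waff p.2 & x = (p.1 * p.2)%g]).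

Definition Zpart (x : extaff) : extaff := (Zdecomp x).1.
Definition hat (x : extaff) : extaff := (Zdecomp x).2.

Definition len (x : extaff) : nat := size (redword (hat x)).

(* x has minimal length in the coset x W. *)
Definition minrep (x : extaff) : Prop :=
  forall w : weyl, (len x <= len (x * of_weyl w)%g)%N.


(* Sym_Q(V), as polynomials in the coordinates of V. *)
Local Notation SymV := (mpoly.mpoly r rat).
Local Notation FracSym := {fraction (mpoly.mpoly r rat)}.

Definition linform (v : V) : SymV := \sum_(i < r) v i 0 *: 'X_i.

Definition wpoly (w : 'M[rat]_r) (p : SymV) : SymV :=
  p \mPo [tuple linform (col i w) | i < r].

HB.instance Definition _ w := GRing.RMorphism.copy (wpoly w)
  (comp_mpoly [tuple linform (col i w) | i < r]).

Lemma wpolyX w i : wpoly w 'X_i = linform (col i w).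
Proof. by rewrite /wpoly comp_mpolyXU -tnth_nth tnth_mktuple. Qed.

Lemma wpoly_linform w v : wpoly w (linform v) = linform (w *m v).
Proof.
rewrite [in LHS]/linform rmorph_sum /= /linform.
under eq_bigr => i _.
  rewrite /wpoly comp_mpolyZ -/(wpoly w 'X_i) wpolyX /linform scaler_sumr.
  over.
rewrite exchange_big; apply: eq_bigr => j _ /=.
rewrite !mxE scaler_suml; apply: eq_bigr => i _.
by rewrite scalerA !mxE mulrC.
Qed.

Lemma wpoly_ext (f g : {rmorphism SymV -> SymV}) :
  (forall c, f c%:MP_[r] = c%:MP_[r]) -> (forall c, g c%:MP_[r] = c%:MP_[r]) ->
  (forall i, f 'X_i = g 'X_i) -> f =1 g.
Proof.
move=> fC gC fg p; rewrite (mpolyE p) !rmorph_sum; apply: eq_bigr => m _.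
rewrite -mul_mpolyC !rmorphM /= fC gC mpolyXE_id !rmorph_prod; congr (_ * _).
by apply: eq_bigr => i _; rewrite !rmorphXn /= fg.
Qed.

Lemma wpolyC w c : wpoly w c%:MP_[r] = c%:MP_[r].
Proof. by rewrite /wpoly comp_mpolyC. Qed.

Lemma wpoly1 p : wpoly 1%:M p = p.
Proof.
rewrite -[RHS]comp_mpoly_id /wpoly; congr comp_mpoly.
apply: eq_mktuple => i; rewrite /linform (bigD1 i) //= big1 ?addr0.
  by rewrite !mxE eqxx scale1r.
by move=> j ji; rewrite !mxE (negbTE ji) scale0r.
Qed.

Lemma wpolyM u w p : wpoly (u *m w) p = wpoly u (wpoly w p).
Proof.
apply: (wpoly_ext (f := wpoly (u *m w)) (g := wpoly u \o wpoly w)) => [c|c|i] /=.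
- exact: wpolyC.
- by rewrite !wpolyC.
- by rewrite !wpolyX wpoly_linform; congr linform; rewrite !colE mulmxA.
Qed.

Lemma wpoly_inj (w : weyl) : injective (wpoly w).
Proof.
by apply: (can_inj (g := wpoly (invmx w))) => p; rewrite -wpolyM mulVmx ?weyl_unit ?wpoly1.
Qed.

(* The action of W~_aff on Frac(S), through the quotient W. *)
Definition wfrac (x : extaff) : FracSym -> FracSym := fracmap (wpoly (weyl_part x)).

HB.instance Definition _ x := GRing.isZmodMorphism.Build FracSym FracSym (wfrac x)
  (fracmap_zmod (@wpoly_inj (weyl_part x))).
HB.instance Definition _ x := GRing.isMonoidMorphism.Build FracSym FracSym (wfrac x)
  (fracmap_monoid (@wpoly_inj (weyl_part x))).

Lemma wfrac1 f : wfrac 1%g f = f.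
Proof.
rewrite [RHS]frac_repr /wfrac /fracmap.
by congr (_ / _); congr FracField.tofrac; exact: wpoly1.
Qed.

Lemma wfracM x y f : wfrac (x * y)%g f = wfrac x (wfrac y f).
Proof.
have nz : \d_(generic_quotient.repr f) != 0 by rewrite denom_ratioP.
have nzy := fmorph_neq0 (@wpoly_inj (weyl_part y)) nz.
have E := fracmap_div (@wpoly_inj (weyl_part x))
            (wpoly (weyl_part y) \n_(generic_quotient.repr f)) nzy.
rewrite [RHS]E /wfrac /fracmap.
by congr (_ / _); congr FracField.tofrac; exact: wpolyM.
Qed.

Definition Qaff := {malg FracSym[extaff]}.
HB.instance Definition _ := GRing.Zmodule.on Qaff.
HB.instance Definition _ := GRing.Zmodule_isNzRing.Build Qaff
  (crossed_mulA wfracM) (crossed_mul1l wfrac1) (crossed_mul1r wfrac)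
  (crossed_mulDl wfrac) (crossed_mulDr wfrac) (crossed_one_neq0 _ _).

(* Frac(S) is embedded in Q~_aff as the multiples of delta_e. *)
Definition qscal (f : FracSym) : Qaff := << f *g 1%g >>.
Definition delta (x : extaff) : Qaff := << 1 *g x >>.

(* The finite part of alpha_0 is -Theta, hence A_0 = -1/Theta (1 - delta_s0). *)
Definition Agen (i : 'I_r.+1) : Qaff :=
  qscal (FracField.tofrac (linform (aff_alpha i).1))^-1
  * (1 - delta (aff_refl i)).

Definition Adem (w : extaff) : Qaff := \prod_(i <- redword w) Agen i.
Definition Atil (x : extaff) : Qaff := delta (Zpart x) * Adem (hat x).

Definition in_weight (v : V) : Prop :=
  forall a, a \in roots D -> pairing (coroot D a) v \is a Num.int.

(* S = Sym(P), as the subring of Sym_Q(V) generated by P: since P spans V, the *)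
(* canonical map Sym(P) -> Sym_Q(V) is injective and Frac(S) = Frac(Sym_Q(V)). *)
Inductive in_symP : SymV -> Prop :=
  | symP_weight v : in_weight v -> in_symP (linform v)
  | symP_1 : in_symP 1
  | symP_B p q : in_symP p -> in_symP q -> in_symP (p - q)
  | symP_M p q : in_symP p -> in_symP q -> in_symP (p * q).

Definition symP_pred : pred SymV := fun p => `[< in_symP p >].

Lemma symP_subring : subring_closed symP_pred.
Proof.
split=> [|p q /asboolP Sp /asboolP Sq|p q /asboolP Sp /asboolP Sq]; apply/asboolP.
- exact: symP_1.
- exact: symP_B.
- exact: symP_M.
Qed.
HB.instance Definition _ := GRing.isSubringClosed.Build SymV symP_pred symP_subring.

Record symP := SymP { symP_val :> SymV; _ : symP_pred symP_val }.
HB.instance Definition _ := [isSub for symP_val].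
HB.instance Definition _ := [Choice of symP by <:].
HB.instance Definition _ := [SubChoice_isSubComNzRing of symP by <:].

Definition Sscal (s : symP) : Qaff := qscal (FracField.tofrac (symP_val s)).

(* Membership in the S-span of the Atil x. *)
Definition in_Aaff (a : Qaff) : Prop :=
  exists c : seq (symP * extaff), a = \sum_(p <- c) Sscal p.1 * Atil p.2.

Definition in_ZAaff (a : Qaff) : Prop :=
  in_Aaff a /\ forall s : symP, a * Sscal s = Sscal s * a.

Definition in_ideal (a : Qaff) : Prop :=
  exists b : weyl -> Qaff, (forall y, in_Aaff (b y)) /\
    a = \sum_(y : weyl | y != 1%g) b y * Adem (of_weyl y).

(* H_*^T(Omega K^ad) as an S-algebra, with its Schubert basis (indexed by the  *)
(* minimal length representatives; the values of schubert elsewhere are        *)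
(* irrelevant) and the isomorphism j^ad onto the centralizer.  Each            *)
(* jad (schubert x) is pinned down by jad_image and jad_schubert, because the  *)
(* centralizer meets the left ideal in_ideal trivially.                        *)
Record grassmannian_homology := GrassmannianHomology {
  homT : comAlgType symP;
  schubert : extaff -> homT;
  jad : {rmorphism homT -> Qaff};
  schubert_basis : forall h : homT, exists! c : {malg symP[extaff]},
    (forall x, x \in msupp c -> minrep x) /\
    h = \sum_(x <- msupp c) c@_x *: schubert x;
  jad_scale : forall (s : symP) (h : homT), jad (s *: h) = Sscal s * jad h;
  jad_inj : injective jad;
  jad_image : forall a, (exists h, jad h = a) <-> in_ZAaff a;
  jad_schubert : forall x, minrep x -> in_ideal (jad (schubert x) - Atil x)
}.

Definition antidominant (l : coweight) : Prop :=
  forall i : 'I_r, pairing l (alpha D i) <= 0.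

Definition parabolic (l : coweight) : {set weyl} :=
  <<[set wrefl (alpha_root D i) | i : 'I_r & pairing l (alpha D i) == 0%R]>>%g.

End RootSystem.

(* Main.v *)
Require Import Defs.
From mathcomp Require Import all_boot all_order all_fingroup all_algebra finmap.
From mathcomp Require Import boolp mpoly monalg ring lra zify.
From mathcomp Require classical_sets.

(** Write [A~_x] for [Atil x], [A_y] for [Adem y], and [e_0] for the sum of the
  [delta_w], [w] in the finite Weyl group [W]. The class [j(xi)] of
  [xi = xi_(t_mu)] is pinned down by two properties: it commutes with [S], and it
  is congruent to [A~_(t_mu)] modulo the left ideal generated by the [A_y] with
  [y] in [W - 1]. Every such [A_y] ends with a finite generator [A_i] and
  [A_i e_0 = 0], so the ideal is killed by right multiplication by [e_0]. On the
  other hand an element commuting with [S] is a combination of translations, and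
  such a combination is killed by [e_0] only if it is zero ([central_kill]). It
  therefore suffices to compare commutators with [S] and products with [e_0].

  Product with [e_0]. A point [l] of the orbit of [mu] other than [mu] is not
  antidominant ([antidominant_parabolic]), so some finite simple reflection [s_j]
  shortens [t_l]. Then [A~_(t_l)] ends with [A_j] and is killed by [e_0]
  ([Atil_transl_kill]); only the term [l = mu] survives.

  Commutation with [S]. For a linear form [v], the nil-Hecke relation
  [A_i v = s_i(v) A_i + <alpha_i^v, v>] yields
  [A~_x v = x(v) A~_x + sum <b^v, v> A~_(x s_b)], where [b] runs over the positive
  affine roots made negative by [x] for which [x s_b] is shorter than [x] by
  exactly one ([Atil_qlin]). For a translation [x = t_l] the finite part is
  trivial, so that the sum is the commutator. When [l] runs over an orbit of [W],
  every element [t_l s_b] with [b = (a, n)] is met a second time from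
  [t_(s_a l)], with the finite part [- a] of the root and hence with the opposite
  coefficient, and all the corrections cancel ([orbit_sum_opp]). The sum is taken
  over [W] and divided by the order of the stabiliser, the crossed product being
  torsion-free.

  Both parts use that [A_x] does not depend on the reduced word of [x]
  ([Aw_word_value]). By induction on the length, the difference [g] of the products
  over two reduced words of [x] satisfies [g v = x(v) g], because its correction
  terms are products over shorter words; hence [g] is supported on elements with
  the same finite part as [x]. If the two words end in [i] and [j], choose a point
  fixed by both [s_i] and [s_j] ([common_fixed_point]). The sum [e] over the
  stabiliser of this point satisfies [A_i e = A_j e = 0], so [g e = 0]; as the
  stabiliser contains no translation, [g = 0] ([intertwiner_stab_sum]). No braid
  relation has to be checked. *)

Set Implicit Arguments.
Unset Strict Implicit.
Unset Printing Implicit Defensive.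

Import Order.TTheory GRing.Theory Num.Theory.
Local Open Scope ring_scope.

Local Notation roots := Defs.roots.

Section Pairing.
Variable r : nat.
Implicit Types (u v : 'cV[rat]_r) (l m : 'rV[rat]_r) (w : 'M[rat]_r).

Lemma pairingDr l u v : pairing l (u + v) = pairing l u + pairing l v.
Proof. by rewrite /pairing mulmxDr mxE. Qed.

Lemma pairingZr l c v : pairing l (c *: v) = c * pairing l v.
Proof. by rewrite /pairing -scalemxAr mxE. Qed.

Lemma pairingNr l v : pairing l (- v) = - pairing l v.
Proof. by rewrite -scaleN1r pairingZr mulN1r. Qed.

Lemma pairing0r l : pairing l 0 = 0.
Proof. by rewrite /pairing mulmx0 mxE. Qed.

Lemma pairing_sumr l (I : Type) (s : seq I) (P : pred I) F :
  pairing l (\sum_(i <- s | P i) F i) = \sum_(i <- s | P i) pairing l (F i).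
Proof. exact: (big_morph _ (pairingDr l) (pairing0r l)). Qed.

Lemma pairingDl l m v : pairing (l + m) v = pairing l v + pairing m v.
Proof. by rewrite /pairing mulmxDl mxE. Qed.

Lemma pairingZl c l v : pairing (c *: l) v = c * pairing l v.
Proof. by rewrite /pairing -scalemxAl mxE. Qed.

Lemma pairingNl l v : pairing (- l) v = - pairing l v.
Proof. by rewrite -scaleN1r pairingZl mulN1r. Qed.

Lemma pairing0l v : pairing 0 v = 0.
Proof. by rewrite /pairing mul0mx mxE. Qed.

Lemma pairingM l w v : pairing (l *m w) v = pairing l (w *m v).
Proof. by rewrite /pairing mulmxA. Qed.

Definition pairingE := (pairingDr, pairingZr, pairingNr, pairingDl, pairingZl,
  pairingNl, pairing0l, pairing0r).

Lemma pairing_ext l m : (forall v, pairing l v = pairing m v) -> l = m.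
Proof.
move=> E; apply/matrixP => i j; have := E (delta_mx j 0).
by rewrite /pairing -!colE !mxE ord1.
Qed.

Lemma mulmx_ext (m : nat) (w w' : 'M[rat]_(m, r)) :
  (forall v : 'cV_r, w *m v = w' *m v) -> w = w'.
Proof.
move=> E; apply/matrixP => i j; have := E (delta_mx j 0).
by rewrite -!colE => /matrixP/(_ i 0); rewrite !mxE.
Qed.

End Pairing.

Section FiniteRoots.
Variables (r : nat) (D : root_system r).
Local Notation V := 'cV[rat]_r.
Implicit Types (a b v : V) (l : 'rV[rat]_r) (w : weyl D).

Lemma root_opp a : a \in roots D -> - a \in roots D.
Proof.
move=> Ra; have := roots_reflection Ra Ra.
by rewrite coroot_root // scaler_nat mulr2n opprD addNKr.
Qed.

Lemma root_neq0 a : a \in roots D -> a != 0.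
Proof. by apply: contraTneq => ->; exact: roots_neq0. Qed.

(** The product of the reflections defined by [f] and by the coroot of [a] moves
  every root [b] by a multiple [d b] of [a]. As [d a = 0], its iterates move [b]
  by the multiples of [d b *: a], and finiteness of the root system forces
  [d b = 0]. *)
Lemma coroot_unique a f : a \in roots D -> pairing f a = 2 ->
  (forall b, b \in roots D -> b - pairing f b *: a \in roots D) ->
  coroot D a = f.
Proof.
move=> Ra fa fR; pose d v := pairing (coroot D a) v - pairing f v.
have da : d a = 0 by rewrite /d coroot_root // fa subrr.
have step b : b \in roots D -> b + d b *: a \in roots D.
  move=> Rb; have := fR _ (roots_reflection Ra Rb).
  suff -> : b + d b *: a = b - pairing (coroot D a) b *: a
      - pairing f (b - pairing (coroot D a) b *: a) *: a by [].
  rewrite !pairingE fa -addrA -!scaleNr -scalerDl /d.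
  by congr (_ + _ *: _); ring.
have iter b n : b \in roots D -> b + (n%:R * d b) *: a \in roots D.
  move=> Rb; elim: n => [|n /step]; first by rewrite mul0r scale0r addr0.
  have -> : d (b + (n%:R * d b) *: a) = d b.
    by rewrite -[RHS]addr0 -[in RHS](mulr0 (n%:R * d b)) -da /d !pairingE; ring.
  by rewrite -addrA -scalerDl -natr1 mulrDl mul1r.
have d0 b : b \in roots D -> d b = 0.
  move=> Rb; apply: contraTeq isT => db.
  pose s := [seq b + (n%:R * d b) *: a | n <- iota 0 (size (roots D)).+1].
  have Us : uniq s.
    rewrite map_inj_uniq ?iota_uniq // => m n /addrI /eqP.
    rewrite -subr_eq0 -scalerBl scaler_eq0 (negbTE (root_neq0 Ra)) orbF.
    by rewrite -mulrBl mulf_eq0 (negbTE db) orbF subr_eq0 eqr_nat => /eqP.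
  have /(uniq_leq_size Us) : {subset s <= roots D}.
    by move=> x /mapP[n _ ->]; exact: iter.
  by rewrite size_map size_iota ltnn.
apply: pairing_ext => v; apply/eqP; rewrite -subr_eq0; apply/eqP.
have : v \in <<roots D>>%VS by rewrite roots_span memvf.
move/(@coord_span _ _ _ (in_tuple (roots D))) => ->.
rewrite !pairing_sumr -sumrB big1 // => i _.
rewrite !pairingZr -mulrBr -/(d _) d0 ?mulr0 //.
exact: mem_nth.
Qed.

Lemma weylK w v : invmx w *m (weyl_mx w *m v) = v.
Proof. by rewrite mulKmx // weyl_unit. Qed.

Lemma weylVK w v : weyl_mx w *m (invmx w *m v) = v.
Proof. by rewrite mulKVmx // weyl_unit. Qed.

Lemma coroot_weyl w a v : a \in roots D ->
  pairing (coroot D (weyl_mx w *m a)) (weyl_mx w *m v) = pairing (coroot D a) v.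
Proof.
move=> Ra; rewrite (@coroot_unique _ (coroot D a *m invmx w)) ?weyl_roots //.
- by rewrite pairingM weylK.
- by rewrite pairingM weylK coroot_root.
- move=> b Rb; rewrite pairingM -{1}(weylVK w b) scalemxAr -mulmxBr weyl_roots //.
  by apply: roots_reflection => //; exact: (weyl_roots w^-1%g Rb).
Qed.

Lemma coroot_opp a : a \in roots D -> coroot D (- a) = - coroot D a.
Proof.
move=> Ra; apply: coroot_unique; rewrite ?root_opp //.
  by rewrite !pairingE coroot_root // opprK.
by move=> b Rb; rewrite !pairingE scaleNr scalerN opprK roots_reflection.
Qed.

Lemma refl_opp a : a \in roots D -> refl_mx D (- a) = refl_mx D a.
Proof. by move=> Ra; rewrite /refl_mx coroot_opp // mulmxN mulNmx opprK. Qed.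

End FiniteRoots.

(** * Affine roots, height and positivity *)

Section AffineRoots.
Variables (r : nat) (D : root_system r).
Local Notation V := 'cV[rat]_r.
Local Notation aroot := (V * rat)%type.
Local Notation asimple := (aff_alpha D).
Implicit Types (a v : V) (b c : aroot) (w : weyl D) (x y : extaff D).

Lemma asimple0 : asimple ord0 = (- Theta D, 1).
Proof. by rewrite /aff_alpha unlift_none. Qed.

Lemma asimple_lift j : asimple (lift ord0 j) = (alpha D j, 0).
Proof. by rewrite /aff_alpha liftK. Qed.

Definition is_aroot b := (b.1 \in roots D) && (b.2 \is a Num.int).

Definition asub b k c : aroot := (b.1 - k *: c.1, b.2 - k * c.2).

Lemma asimple_aroot i : is_aroot (asimple i).
Proof.
case: (unliftP ord0 i) => [j|] ->; first by rewrite asimple_lift /is_aroot alpha_root.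
by rewrite asimple0 /is_aroot root_opp // Theta_root.
Qed.

Lemma coweight_int (l : coweight D) a : a \in roots D -> pairing l a \is a Num.int.
Proof. by have /allP := valP l; apply. Qed.

Lemma aff_act_aroot x b : is_aroot b -> is_aroot (aff_act x b).
Proof.
case/andP=> Ra nb; rewrite /is_aroot /aff_act /= weyl_roots //=.
by rewrite rpredB ?coweight_int ?weyl_roots.
Qed.

Lemma aff_act1 b : aff_act (1%g : extaff D) b = b.
Proof. by case: b => a n; rewrite /aff_act /= mul1mx /pairing mul0mx mxE subr0. Qed.

Lemma aff_actM x y b : aff_act (x * y)%g b = aff_act x (aff_act y b).
Proof.
rewrite /aff_act /=; congr (_, _); first by rewrite mulmxA.
rewrite pairingDl pairingM -!mulmxA mulKmx ?weyl_unit //.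
by rewrite opprD addrA addrAC.
Qed.

Lemma aff_actK x b : aff_act x^-1%g (aff_act x b) = b.
Proof. by rewrite -aff_actM mulVg aff_act1. Qed.

Lemma aff_actVK x b : aff_act x (aff_act x^-1%g b) = b.
Proof. by rewrite -aff_actM mulgV aff_act1. Qed.

Lemma aff_act_sub x b k c : aff_act x (asub b k c) = asub (aff_act x b) k (aff_act x c).
Proof.
rewrite /aff_act /asub /= mulmxBr -scalemxAr; congr (_, _).
by rewrite !pairingE; ring.
Qed.

Lemma extaff_ext x y : (coweight_row (trans_part x) = coweight_row (trans_part y)) ->
  weyl_mx (weyl_part x) = weyl_mx (weyl_part y) -> x = y.
Proof. by case: x y => [l w] [l' w'] /= E F; congr ExtAff; apply: val_inj. Qed.

Lemma aff_act_faithful x y : (forall b, aff_act x b = aff_act y b) -> x = y.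
Proof.
move=> E; have wE : weyl_mx (weyl_part x) = weyl_mx (weyl_part y).
  by apply: mulmx_ext => v; have := E (v, 0) => -[].
apply: extaff_ext => //; apply: pairing_ext => v.
have [_] := E (invmx (weyl_part x) *m v, 0).
by rewrite -wE weylVK => /addrI/oppr_inj.
Qed.

Definition simple_tuple : r.-tuple V := [tuple of map_tuple (alpha D) (ord_tuple r)].

Lemma simple_basis : basis_of fullv simple_tuple.
Proof. exact: alpha_basis. Qed.

Definition om j : V -> rat := coord simple_tuple j.

Lemma simple_tuple_nth (j : 'I_r) : simple_tuple`_j = alpha D j.
Proof. by rewrite -tnth_nth tnth_map tnth_ord_tuple. Qed.

Lemma om_alpha i j : om i (alpha D j) = (i == j)%:R.
Proof.
by rewrite -simple_tuple_nth /om coord_free 1?eq_sym //; exact: basis_free simple_basis.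
Qed.

Lemma om_sum v : v = \sum_j om j v *: alpha D j.
Proof.
rewrite {1}(coord_basis simple_basis (memvf v)).
by apply: eq_bigr => i _; rewrite simple_tuple_nth.
Qed.

Lemma omB j u v : om j (u - v) = om j u - om j v. Proof. exact: linearB. Qed.
Lemma omN j v : om j (- v) = - om j v. Proof. exact: linearN. Qed.
Lemma omZ j (c : rat) v : om j (c *: v) = c * om j v. Proof. exact: linearZ. Qed.
Lemma om_sumr j (I : Type) (s : seq I) (P : pred I) F :
  om j (\sum_(i <- s | P i) F i) = \sum_(i <- s | P i) om j (F i).
Proof. exact: linear_sum. Qed.

Lemma om_nat j (c : 'I_r -> nat) : om j (\sum_i (c i)%:R *: alpha D i) = (c j)%:R.
Proof.
rewrite om_sumr (bigD1 j) //= big1 ?addr0 => [|i ij]; rewrite omZ om_alpha.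
  by rewrite eqxx mulr1.
by rewrite eq_sym (negbTE ij) mulr0.
Qed.

Lemma om_root a : a \in roots D ->
  (forall j, om j a \is a Num.nat) \/ (forall j, - om j a \is a Num.nat).
Proof.
by move=> /alpha_base[c [] ->]; [left|right] => j; rewrite ?omN ?opprK om_nat natr_nat.
Qed.

Lemma om_Theta_sub a j : a \in roots D -> om j (Theta D) - om j a \is a Num.nat.
Proof. by move=> /Theta_highest[c E]; rewrite -omB E om_nat natr_nat. Qed.

Lemma om_Theta_ge0 j : 0 <= om j (Theta D).
Proof.
have := natr_ge0 (om_Theta_sub j (root_opp (Theta_root D))).
by rewrite omN; lra.
Qed.

Lemma om_int a j : a \in roots D -> om j a \is a Num.int.
Proof. by move=> /om_root[/(_ j)|/(_ j)] /intr_nat //; rewrite rpredN. Qed.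

(** The coordinates on the affine simple roots: [(a, n)] is [n] times
  [alpha_0 = (- Theta, 1)] plus the vector [a + n Theta] of the finite span. *)
Definition kap (i : 'I_r.+1) b : rat :=
  if unlift ord0 i is Some j then om j b.1 + b.2 * om j (Theta D) else b.2.

Lemma kap0 b : kap ord0 b = b.2.
Proof. by rewrite /kap unlift_none. Qed.

Lemma kap_lift j b : kap (lift ord0 j) b = om j b.1 + b.2 * om j (Theta D).
Proof. by rewrite /kap liftK. Qed.

Lemma kap_sub i b k c : kap i (asub b k c) = kap i b - k * kap i c.
Proof.
by rewrite /kap; case: unlift => [j|] //=; rewrite omB omZ; ring.
Qed.

Lemma kap_asimple i j : kap i (asimple j) = (i == j)%:R.
Proof.
case: (unliftP ord0 i) => [i'|] ->; rewrite ?kap0 ?kap_lift;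
  case: (unliftP ord0 j) => [j'|] ->; rewrite ?asimple0 ?asimple_lift /=.
- by rewrite om_alpha mul0r addr0 (inj_eq lift_inj).
- by rewrite omN mul1r addNr.
- by [].
- by [].
Qed.

Lemma kap_sum1 b : b.1 = \sum_i kap i b *: (asimple i).1.
Proof.
rewrite big_ord_recl kap0 asimple0 /=.
under eq_bigr => j _ do rewrite kap_lift asimple_lift /= scalerDl.
rewrite big_split /= -om_sum.
under eq_bigr => j _ do rewrite -scalerA.
by rewrite -scaler_sumr -om_sum scalerN addrCA addNr addr0.
Qed.

Lemma kap_sum2 b : b.2 = \sum_i kap i b * (asimple i).2.
Proof.
rewrite big_ord_recl kap0 asimple0 /= big1 ?addr0 ?mulr1 // => j _.
by rewrite asimple_lift mulr0.
Qed.

Lemma kap_act i x b : kap i (aff_act x b) = \sum_j kap j b * kap i (aff_act x (asimple j)).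
Proof.
case: (unliftP ord0 i) => [i'|] -> /=.
  under eq_bigr => j _ do rewrite kap_lift mulrDr.
  rewrite kap_lift big_split /= {1}(kap_sum1 b) mulmx_sumr om_sumr.
  congr (_ + _); first by apply: eq_bigr => j _; rewrite -scalemxAr omZ.
  under eq_bigr => j _ do rewrite mulrA.
  rewrite -mulr_suml; congr (_ * _).
  rewrite {1}(kap_sum2 b) {1}(kap_sum1 b) mulmx_sumr pairing_sumr -sumrB.
  by apply: eq_bigr => j _; rewrite -scalemxAr pairingZr mulrBr.
rewrite kap0; under eq_bigr => j _ do rewrite kap0.
rewrite /= {1}(kap_sum2 b) {1}(kap_sum1 b) mulmx_sumr pairing_sumr -sumrB.
by apply: eq_bigr => j _; rewrite -scalemxAr pairingZr mulrBr.
Qed.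

Lemma kap_int i b : is_aroot b -> kap i b \is a Num.int.
Proof.
case/andP=> Ra nb; case: (unliftP ord0 i) => [j|] ->; rewrite ?kap0 ?kap_lift //.
by rewrite rpredD ?rpredM ?om_int ?Theta_root.
Qed.

(** Since [Theta] is the highest root, [Theta + a] is a sum of simple roots for
  every root [a]. *)
Lemma kap_ge0_pos b i : is_aroot b -> 0 < b.2 -> 0 <= kap i b.
Proof.
case/andP=> Ra /intrP[n nE] n0.
case: (unliftP ord0 i) => [j|] ->; rewrite ?kap0 ?kap_lift; last exact: ltW.
have n1 : 1 <= b.2 by move: n0; rewrite nE ltr0z ler1z.
have := natr_ge0 (om_Theta_sub j (root_opp Ra)); rewrite omN.
by have := om_Theta_ge0 j; nra.
Qed.

Lemma aroot_opp b : is_aroot b -> is_aroot (- b.1, - b.2).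
Proof. by case/andP=> Ra nb; rewrite /is_aroot /= root_opp // rpredN. Qed.

Lemma kap_opp i b : kap i (- b.1, - b.2) = - kap i b.
Proof. by rewrite /kap; case: unlift => [j|] //=; rewrite omN; ring. Qed.

Lemma kap_sign b : is_aroot b -> (forall i, 0 <= kap i b) \/ (forall i, kap i b <= 0).
Proof.
move=> Rb; have [n0|n0|n0] := ltgtP 0 b.2.
- by left=> i; apply: kap_ge0_pos.
- right=> i; rewrite -oppr_ge0 -kap_opp; apply: kap_ge0_pos; first exact: aroot_opp.
  by rewrite /= oppr_gt0.
- have K i : kap i b = if unlift ord0 i is Some j then om j b.1 else 0.
    by rewrite /kap -n0; case: unlift => [j|] //; rewrite mul0r addr0.
  have [/andP[Ra _]] := Rb; have [H|H] := om_root Ra; [left|right] => i; rewrite K.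
    by case: unlift => [j|//]; exact: natr_ge0.
  by case: unlift => [j|//]; rewrite -oppr_ge0; exact: natr_ge0.
Qed.

(** The affine height takes the value 1 on every simple root, so that it is
  positive exactly on the real affine roots [a + n eps] that are positive in the
  usual sense ([n > 0], or [n = 0] and [a > 0]). *)
Definition ht b : rat := \sum_i kap i b.
Definition apos b := 0 < ht b.

Lemma ht_sub b k c : ht (asub b k c) = ht b - k * ht c.
Proof.
rewrite /ht mulr_sumr -sumrB.
by apply: eq_bigr => i _; rewrite kap_sub.
Qed.

Lemma ht_opp b : ht (- b.1, - b.2) = - ht b.
Proof. by rewrite /ht -sumrN; apply: eq_bigr => i _; rewrite kap_opp. Qed.

Lemma ht_asimple i : ht (asimple i) = 1.
Proof.
rewrite /ht (bigD1 i) //= kap_asimple eqxx big1 ?addr0 // => j ji.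
by rewrite kap_asimple (negbTE ji).
Qed.

Lemma ht_act x b : ht (aff_act x b) = \sum_i kap i b * ht (aff_act x (asimple i)).
Proof.
rewrite /ht; under eq_bigr => i _ do rewrite kap_act.
by rewrite exchange_big; apply: eq_bigr => j _; rewrite mulr_sumr.
Qed.

Lemma ht_int b : is_aroot b -> ht b \is a Num.int.
Proof. by move=> Rb; rewrite rpred_sum // => i _; exact: kap_int. Qed.

Lemma kap_eq0 b : (forall i, kap i b = 0) -> b = (0, 0).
Proof.
move=> K; case: b K => a n K; have := kap_sum1 (a, n); have := kap_sum2 (a, n).
by rewrite !big1 /= => [->->|i _|i _] //; rewrite K ?scale0r ?mul0r.
Qed.

Lemma ht_neq0 b : is_aroot b -> ht b != 0.
Proof.
move=> Rb; apply/eqP => h0.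
suff /kap_eq0 E : forall i, kap i b = 0.
  by case/andP: Rb; rewrite E => /root_neq0; rewrite eqxx.
have [K|K] := kap_sign Rb => i; apply/eqP.
  by move/eqP: h0; rewrite psumr_eq0 // => /allP/(_ i (mem_index_enum i)).
move/eqP: h0; rewrite -oppr_eq0 /ht -sumrN psumr_eq0 => [|j _]; last by rewrite oppr_ge0.
by move=> /allP/(_ i (mem_index_enum i)) /=; rewrite oppr_eq0.
Qed.

Lemma apos_opp b : is_aroot b -> apos (- b.1, - b.2) = ~~ apos b.
Proof.
move=> Rb; rewrite /apos ht_opp oppr_gt0 -leNgt lt_neqAle.
by rewrite ht_neq0.
Qed.

Lemma apos_ge1 b : is_aroot b -> apos b -> 1 <= ht b.
Proof. by move=> /ht_int/intrP[n E]; rewrite /apos E ltr0z ler1z. Qed.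

Lemma apos_kap b : is_aroot b -> apos b -> forall i, 0 <= kap i b.
Proof.
move=> Rb pb; have [//|K] := kap_sign Rb.
by move: pb; rewrite /apos ltNge sumr_le0.
Qed.

Lemma kap_apos b i : is_aroot b -> 0 < kap i b -> apos b.
Proof.
move=> Rb ki; have [K|K] := kap_sign Rb; last by rewrite ltNge K in ki.
by rewrite /apos lt_neqAle eq_sym ht_neq0 ?sumr_ge0.
Qed.

Lemma asimple_apos i : apos (asimple i).
Proof. by rewrite /apos ht_asimple. Qed.

Definition fht a : rat := \sum_j om j a.

Lemma fht_neq0 a : a \in roots D -> fht a != 0.
Proof.
move=> Ra; have : is_aroot (a, 0) by rewrite /is_aroot Ra.
move=> /ht_neq0; rewrite /ht big_ord_recl kap0 add0r.
by under eq_bigr => j _ do rewrite kap_lift mul0r addr0.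
Qed.

(** 0 for a positive root and 1 for a negative one: the smallest [n] for which
  the affine root [(a, n)] is positive. *)
Definition chi a : nat := (fht a < 0)%R.

(** The finite heights are bounded by that of [Theta], and the null root has
  height [1 + fht Theta]; hence the sign of the height is that of [n], except for
  [n = 0]. *)
Lemma aposE a n : is_aroot (a, n) -> apos (a, n) = ((chi a)%:R <= n).
Proof.
move=> Ran; have /andP[/= Ra nZ] := Ran.
have hE : ht (a, n) = n * (1 + fht (Theta D)) + fht a.
  rewrite /ht big_ord_recl kap0; under eq_bigr => j _ do rewrite kap_lift.
  by rewrite big_split /= -mulr_sumr -!/(fht _); ring.
have bnd v : v \in roots D -> fht v <= fht (Theta D).
  move=> Rv; rewrite -subr_ge0 -sumrB sumr_ge0 // => j _.
  exact: natr_ge0 (om_Theta_sub j Rv).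
have T0 : 0 <= fht (Theta D) by rewrite sumr_ge0 // => j _; exact: om_Theta_ge0.
have b1 := bnd _ Ra; have b2 : - fht a <= fht (Theta D).
  by rewrite -sumrN; under eq_bigr => j _ do rewrite -omN; exact/bnd/root_opp.
have nz := fht_neq0 Ra.
rewrite /apos hE /chi; move/intrP: nZ => [m ->].
rewrite -[X in X <= _]/((Posz (fht a < 0)%R)%:~R) ler_int.
have [m1|m1|<-] := ltgtP 0 m.
- have m2 : 1 <= m%:~R :> rat by rewrite ler1z.
  have -> : 0 < m%:~R * (1 + fht (Theta D)) + fht a by nra.
  by case: (fht a < 0) => /=; lia.
- have m2 : m%:~R <= -1 :> rat by rewrite -[-1]/(-1)%:~R ler_int; lia.
  have -> : 0 < m%:~R * (1 + fht (Theta D)) + fht a = false.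
    by apply/negbTE; rewrite -leNgt; nra.
  by case: (fht a < 0) => /=; lia.
- rewrite mul0r add0r; case: ltgtP nz => //.
Qed.

End AffineRoots.

(** * Affine reflections and inversions *)

Section Inversions.
Variables (r : nat) (D : root_system r).
Local Notation V := 'cV[rat]_r.
Local Notation aroot := (V * rat)%type.
Local Notation asimple := (aff_alpha D).
Local Notation s_ := (aff_refl D).
Implicit Types (a v : V) (b c : aroot) (w : weyl D) (x y : extaff D).
Implicit Types (u : seq 'I_r.+1).

Lemma int_ltD1 (m n : rat) : m \is a Num.int -> n \is a Num.int -> m < n -> m + 1 <= n.
Proof.
move=> /intrP[p ->] /intrP[q ->]; rewrite ltr_int => pq.
by rewrite -[1]/(1%:~R) -rmorphD /= ler_int lezD1.
Qed.

(** The reflection [t_(- n a^v) s_a] in the affine root [b = (a, n)]. The default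
  values of [insubd] are taken only when [b] is not an affine root. *)
Definition arefl b : extaff D :=
  ExtAff (insubd 0 (- b.2 *: coroot D b.1)) (insubd (weyl_one D) (refl_mx D b.1)).

Arguments arefl : simpl never.

Lemma arefl_trans b : is_aroot D b ->
  coweight_row (trans_part (arefl b)) = - b.2 *: coroot D b.1.
Proof.
case/andP=> Ra nZ; have S : in_coweight D (- b.2 *: coroot D b.1).
  by apply/allP => c Rc; rewrite pairingZl rpredM ?rpredN ?roots_integral.
by rewrite [LHS](insubdK _ S).
Qed.

Lemma arefl_weyl b : is_aroot D b ->
  weyl_mx (weyl_part (arefl b)) = refl_mx D b.1.
Proof.
case/andP=> Ra _; have S : (fun m : 'M[rat]_r => `[< in_weyl D m >]) (refl_mx D b.1).
  exact/asboolP/in_weyl_refl.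
exact: (@insubdK _ _ (weyl D) (weyl_one D) _ S).
Qed.

Lemma act_arefl b c : is_aroot D b ->
  aff_act (arefl b) c = asub c (pairing (coroot D b.1) c.1) b.
Proof.
move=> Rb; have /andP[Ra _] := Rb.
rewrite /aff_act arefl_trans // arefl_weyl // refl_mxE /asub; congr (_, _).
by rewrite !pairingE coroot_root //; ring.
Qed.

Lemma aff_refl_arefl i : s_ i = arefl (asimple i).
Proof.
have R := asimple_aroot D i; apply: extaff_ext.
  rewrite arefl_trans //; case: (unliftP ord0 i) => [j|] ->.
    by rewrite asimple_lift /aff_refl liftK /= oppr0 scale0r.
  rewrite asimple0 /aff_refl unlift_none /= invmx1 mul0mx addr0.
  by rewrite coroot_opp ?Theta_root // scaleN1r opprK.
rewrite arefl_weyl //; case: (unliftP ord0 i) => [j|] ->.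
  by rewrite asimple_lift /aff_refl liftK.
by rewrite asimple0 /aff_refl unlift_none /= mul1mx refl_opp ?Theta_root.
Qed.

Lemma act_aff_refl i b :
  aff_act (s_ i) b = asub b (pairing (coroot D (asimple i).1) b.1) (asimple i).
Proof. by rewrite aff_refl_arefl act_arefl // asimple_aroot. Qed.

Lemma arefl_opp b : is_aroot D b -> arefl (- b.1, - b.2) = arefl b.
Proof.
move=> Rb; have /andP[Ra _] := Rb; apply: extaff_ext.
  by rewrite !arefl_trans ?aroot_opp //= coroot_opp // scalerN scaleNr opprK scaleNr.
by rewrite !arefl_weyl ?aroot_opp //= refl_opp.
Qed.

Lemma arefl_self b : is_aroot D b -> aff_act (arefl b) b = (- b.1, - b.2).
Proof.
move=> Rb; have /andP[Ra _] := Rb; rewrite act_arefl // coroot_root // /asub.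
by rewrite scaler_nat mulr2n; congr (_, _); rewrite ?opprD ?addNKr //; ring.
Qed.

Lemma asubK b k c : asub (asub b k c) (- k) c = b.
Proof. by case: b => a n; rewrite /asub /= scaleNr opprK subrK mulNr opprK subrK. Qed.

Lemma arefl_sqr b : is_aroot D b -> (arefl b * arefl b)%g = 1%g.
Proof.
move=> Rb; apply: aff_act_faithful => c; have /andP[Ra _] := Rb.
rewrite aff_actM aff_act1 !act_arefl // -[RHS](asubK _ (pairing (coroot D b.1) c.1) b).
by congr asub; rewrite /= !pairingE coroot_root //; ring.
Qed.

Lemma aff_refl_sqr i : (s_ i * s_ i)%g = 1%g.
Proof. by rewrite aff_refl_arefl arefl_sqr // asimple_aroot. Qed.

Lemma aff_reflK i b : aff_act (s_ i) (aff_act (s_ i) b) = b.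
Proof. by rewrite -aff_actM aff_refl_sqr aff_act1. Qed.

Lemma aff_refl_self i : aff_act (s_ i) (asimple i) = (- (asimple i).1, - (asimple i).2).
Proof. by rewrite aff_refl_arefl arefl_self // asimple_aroot. Qed.

(** Reflections are determined by their roots because coroots are equivariant. *)
Lemma arefl_conj x b : is_aroot D b -> (x * arefl b)%g = (arefl (aff_act x b) * x)%g.
Proof.
move=> Rb; apply: aff_act_faithful => c; have /andP[Ra _] := Rb.
rewrite !aff_actM !act_arefl ?aff_act_aroot // aff_act_sub.
by congr asub; rewrite /= coroot_weyl.
Qed.

Lemma aff_refl_arefl_conj i b : is_aroot D b ->
  (arefl b * s_ i)%g = (s_ i * arefl (aff_act (s_ i) b))%g.
Proof.
by move=> Rb; rewrite [RHS]arefl_conj ?aff_act_aroot // aff_reflK.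
Qed.

Lemma act_opp x b : aff_act x (- b.1, - b.2) = (- (aff_act x b).1, - (aff_act x b).2).
Proof. by rewrite /aff_act /= mulmxN pairingNr; congr (_, _); ring. Qed.

(** A simple reflection only changes one coordinate; a positive affine root
  other than the simple root itself has another coordinate that is positive. *)
Lemma aff_refl_apos i b : is_aroot D b -> apos D b -> b != asimple i ->
  apos D (aff_act (s_ i) b).
Proof.
move=> Rb pb bi; have Rsb := aff_act_aroot (s_ i) Rb.
have [[j ji kj]|none] := pselect (exists2 j, j != i & kap D j b != 0).
  apply: (@kap_apos _ _ _ j) => //.
  rewrite act_aff_refl kap_sub kap_asimple (negbTE ji) mulr0 subr0.
  by rewrite lt_neqAle eq_sym kj apos_kap.
have k0 j : j != i -> kap D j b = 0.
  by move=> ji; apply/eqP; apply: contra_notT none => kj; exists j.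
have b1 : b.1 = kap D i b *: (asimple i).1.
  rewrite {1}(kap_sum1 D b) (bigD1 i) //= big1 ?addr0 // => j ji.
  by rewrite k0 // scale0r.
have b2 : b.2 = kap D i b * (asimple i).2.
  rewrite {1}(kap_sum2 D b) (bigD1 i) //= big1 ?addr0 // => j ji.
  by rewrite k0 // mul0r.
have hb : ht D b = kap D i b.
  by rewrite /ht (bigD1 i) //= big1 ?addr0.
have /andP[Ra _] := Rb; have /andP[Ri _] := asimple_aroot D i.
rewrite b1 in Ra; case: (roots_reduced Ri Ra) => k1.
  move: b1 b2; rewrite k1 scale1r mul1r => b1 b2.
  by case/eqP: bi; rewrite [LHS]surjective_pairing b1 b2 -surjective_pairing.
by move: pb; rewrite /apos hb k1.
Qed.

(** The positive affine roots that [x] makes negative, listed explicitly. For each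
  root [a] of the finite system the condition on [(a, n)] is that [n] lies
  between two thresholds: [chi a], and the one beyond which [x (a, n)] is
  positive. *)
Definition inversions x : seq aroot :=
  [seq (a, (chi D a)%:R + k%:R) | a <- undup (roots D),
     k <- iota 0 (Num.truncn (pairing (trans_part x) (weyl_part x *m a)
                              + (chi D (weyl_part x *m a))%:R - (chi D a)%:R))].

Lemma mem_inv x b :
  (b \in inversions x) = [&& is_aroot D b, apos D b & ~~ apos D (aff_act x b)].
Proof.
case: b => a n; apply/idP/idP.
  case/allpairsPdep => a' [k [Ra]]; rewrite mem_undup in Ra.
  rewrite mem_iota add0n /= truncn_gt_nat => kM [-> ->] {a n}.
  have R : is_aroot D (a', (chi D a')%:R + k%:R).
    by rewrite /is_aroot /= Ra rpredD ?rpred_nat.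
  have Rx := aff_act_aroot x R.
  rewrite R aposE // lerDl ler0n /= /aff_act aposE //= -ltNge.
  by move: kM; rewrite -natr1; lra.
case/and3P=> R; have /andP[/= Ra nZ] := R; have Rx := aff_act_aroot x R.
rewrite aposE // /aff_act aposE // -ltNge /= => n1 n2.
have : n - (chi D a)%:R \is a Num.int by rewrite rpredB ?rpred_nat.
case/intrP => m mE; have m0 : 0 <= m by rewrite -(ler0z rat) -mE subr_ge0.
apply/allpairsPdep; exists a, `|m|%N; rewrite mem_undup; split=> //; last first.
  by rewrite natr_absz ger0_norm // -mE addrC subrK.
rewrite mem_iota add0n leq0n /= truncn_gt_nat -natr1 natr_absz ger0_norm // -mE.
have le_n : n + 1 <= pairing (trans_part x) (weyl_part x *m a)
    + (chi D (weyl_part x *m a))%:R.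
  apply: int_ltD1 => //; first by rewrite rpredD ?rpred_nat ?coweight_int ?weyl_roots.
  by lra.
lra.
Qed.

Lemma inv_uniq x : uniq (inversions x).
Proof.
apply: allpairs_uniq_dep; rewrite ?undup_uniq //.
  by move=> a _; exact: iota_uniq.
by move=> [a k] [a' k'] _ _ [/= <- /addrI/eqP]; rewrite eqr_nat => /eqP ->.
Qed.

Definition N x : nat := size (inversions x).

Lemma inv_mulr x i : apos D (aff_act x (asimple i)) ->
  perm_eq (inversions (x * s_ i)%g) (asimple i :: map (aff_act (s_ i)) (inversions x)).
Proof.
move=> xi; have Ri := asimple_aroot D i.
apply: uniq_perm; rewrite ?inv_uniq //=.
  rewrite map_inj_uniq ?inv_uniq ?andbT; last exact: can_inj (aff_reflK i).
  apply/mapP => -[c]; rewrite mem_inv => /and3P[Rc pc _] E.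
  have := aff_reflK i c; rewrite -E aff_refl_self => cE.
  by move: pc; rewrite -cE apos_opp // asimple_apos.
move=> b; rewrite inE mem_inv; have [-> | bi] /= := eqVneq b (asimple i).
  rewrite Ri asimple_apos aff_actM aff_refl_self act_opp apos_opp ?aff_act_aroot //.
  by rewrite negbK.
apply/and3P/mapP => [[Rb pb nb]|[c]].
  exists (aff_act (s_ i) b); last by rewrite aff_reflK.
  by rewrite mem_inv aff_act_aroot // aff_refl_apos //= -aff_actM.
rewrite mem_inv => /and3P[Rc pc nc] ->; rewrite aff_act_aroot // aff_actM aff_reflK nc.
by rewrite aff_refl_apos //; apply: contraNneq nc => ->.
Qed.

Lemma N_mulr x i : apos D (aff_act x (asimple i)) -> N (x * s_ i)%g = (N x).+1.
Proof. by move=> /inv_mulr/perm_size; rewrite /= size_map. Qed.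

Lemma N_mulrV x i : ~~ apos D (aff_act x (asimple i)) -> N x = (N (x * s_ i)%g).+1.
Proof.
move=> nx; rewrite -(@N_mulr _ i) -?mulgA ?aff_refl_sqr ?mulg1 //.
by rewrite aff_actM aff_refl_self act_opp apos_opp ?aff_act_aroot ?asimple_aroot.
Qed.

(** * Words in the simple reflections *)

Local Notation val u := (word_prod D u).

Lemma word_prod_rcons u i : val (rcons u i) = (val u * s_ i)%g.
Proof. by rewrite /word_prod big_rcons. Qed.

(** Deleting the letter [i] of a word [u' i u''] multiplies its value on the
  right by the reflection in [(u'')^-1 alpha_i]; [dels] lists these roots
  together with the shortened words. The recursion, which peels letters off the
  right end, runs on the reversed word. *)
Fixpoint delr (u : seq 'I_r.+1) : seq (aroot * seq 'I_r.+1) :=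
  if u is i :: u' then
    (asimple i, u') :: [seq (aff_act (s_ i) q.1, i :: q.2) | q <- delr u']
  else [::].
Definition dels u := [seq (q.1, rev q.2) | q <- delr (rev u)].

Lemma dels_rcons u i : dels (rcons u i) =
  (asimple i, u) :: [seq (aff_act (s_ i) q.1, rcons q.2 i) | q <- dels u].
Proof.
rewrite /dels rev_rcons /= revK; congr (_ :: _).
by rewrite -!map_comp; apply: eq_map => q /=; rewrite rev_cons.
Qed.

Lemma size_dels u : size (dels u) = size u.
Proof.
elim/last_ind: u => // u i IH.
by rewrite dels_rcons /= size_map IH size_rcons.
Qed.

Lemma delsP u q : q \in dels u ->
  [/\ is_aroot D q.1, (size q.2).+1 = size u & val q.2 = (val u * arefl q.1)%g].
Proof.
elim/last_ind: u q => [//|u i IH] q; rewrite dels_rcons inE => /orP[/eqP ->|].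
  rewrite asimple_aroot size_rcons word_prod_rcons -mulgA -aff_refl_arefl.
  by rewrite aff_refl_sqr mulg1.
case/mapP=> q' /IH[R S E] -> /=; rewrite aff_act_aroot // !size_rcons S.
by rewrite !word_prod_rcons E -!mulgA aff_refl_arefl_conj.
Qed.

(** Exchange property: whatever positive root a word makes negative becomes a
  simple root [alpha_i] just before some letter [i], and deleting this letter
  multiplies by the corresponding reflection. *)
Lemma inv_dels u : {subset inversions (val u) <= map fst (dels u)}.
Proof.
elim/last_ind: u => [|u i IH] b.
  rewrite mem_inv /word_prod big_nil aff_act1 => /and3P[_ pb].
  by rewrite pb.
rewrite mem_inv dels_rcons /= inE word_prod_rcons aff_actM.
have [//|bi] /= := eqVneq b (asimple i); case/and3P=> Rb pb nb.
have : aff_act (s_ i) b \in inversions (val u).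
  by rewrite mem_inv aff_act_aroot // aff_refl_apos.
move/IH/mapP=> [q qu E]; rewrite -map_comp; apply/mapP; exists q => //=.
by rewrite -E aff_reflK.
Qed.

Lemma N_le_size u : (N (val u) <= size u)%N.
Proof.
rewrite -(size_dels u) -(size_map fst); apply: uniq_leq_size (@inv_dels u).
exact: inv_uniq.
Qed.

Lemma perm_dels u : N (val u) = size u -> perm_eq (inversions (val u)) (map fst (dels u)).
Proof.
move=> Nu; have le : (size (map fst (dels u)) <= size (inversions (val u)))%N.
  by rewrite size_map size_dels -Nu.
have [_ E] := uniq_min_size (inv_uniq _) (@inv_dels u) le.
apply: uniq_perm E; first exact: inv_uniq.
exact: leq_size_uniq (inv_uniq _) (@inv_dels u) le.
Qed.

(** * Elements of length zero *)

Lemma in_Z_ht x b : in_Z x -> ht D (aff_act x b) = ht D b.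
Proof.
by case=> s sE; rewrite ht_act; apply: eq_bigr => i _; rewrite sE ht_asimple mulr1.
Qed.

Lemma N_eq0P x : reflect (forall b, is_aroot D b -> apos D b -> apos D (aff_act x b))
  (N x == 0%N).
Proof.
rewrite size_eq0; apply: (iffP eqP) => [inv0 b Rb pb|px].
  by have := mem_inv x b; rewrite inv0 Rb pb in_nil; case: apos.
case E: (inversions x) => [//|b s]; have := mem_head b s; rewrite -E mem_inv.
by case/and3P=> Rb pb; rewrite px.
Qed.

Lemma in_Z_apos x b : in_Z x -> apos D (aff_act x b) = apos D b.
Proof. by move=> xZ; rewrite /apos in_Z_ht. Qed.

(** If [x] keeps all positive roots positive, so does its inverse; hence
  [x alpha_i], a sum of [ht (x alpha_i)] simple roots, comes from a sum of at
  least as many positive roots adding up to [alpha_i], and is simple. *)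
Lemma N0_in_Z x : N x = 0%N -> in_Z x.
Proof.
move/eqP/N_eq0P => px.
have pV b : is_aroot D b -> apos D b -> apos D (aff_act x^-1%g b).
  move=> Rb pb; apply: contraTT pb => nb.
  have := px _ (aroot_opp (aff_act_aroot x^-1%g Rb)).
  by rewrite act_opp aff_actVK !apos_opp ?aff_act_aroot // => ->.
have simple i : exists j, aff_act x (asimple i) = asimple j.
  have Ri := asimple_aroot D i; set b := aff_act x _.
  have Rb : is_aroot D b by exact: aff_act_aroot.
  have pb : apos D b by apply: px => //; exact: asimple_apos.
  have kN := apos_kap Rb pb.
  have hb : ht D b <= 1.
    have <- : ht D (aff_act x^-1%g b) = 1 by rewrite aff_actK ht_asimple.
    rewrite ht_act; apply: ler_sum => j _; rewrite -[leLHS]mulr1.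
    apply: ler_wpM2l => //; apply: apos_ge1.
      by rewrite aff_act_aroot ?asimple_aroot.
    by apply: pV; rewrite ?asimple_aroot ?asimple_apos.
  have [j kj] : exists j, kap D j b != 0.
    apply/existsP; apply: contraT; rewrite negb_exists => /forallP k0.
    move: pb; rewrite /apos /ht big1 ?ltxx // => j _.
    by apply/eqP; rewrite -[_ == _]negbK; exact: k0.
  have kj1 : 1 <= kap D j b.
    have /intrP[n nE] := kap_int j Rb; move: kj (kN j); rewrite nE intr_eq0 ler0z ler1z.
    lia.
  have kz l : l != j -> kap D l b = 0.
    move=> lj; have := hb; rewrite /ht (bigD1 j) //= (bigD1 l) //=.
    have : 0 <= \sum_(i0 | (i0 != j) && (i0 != l)) kap D i0 b by apply: sumr_ge0.
    have := kN l; lra.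
  have kj' : kap D j b = 1.
    have := hb; rewrite /ht (bigD1 j) //= big1 ?addr0 => [|l lj]; last exact: kz.
    by lra.
  exists j; rewrite [LHS]surjective_pairing [RHS]surjective_pairing; congr (_, _).
    by rewrite (kap_sum1 D b) (bigD1 j) //= big1 ?addr0 => [|l /kz ->];
      rewrite ?kj' ?scale1r ?scale0r.
  by rewrite (kap_sum2 D b) (bigD1 j) //= big1 ?addr0 => [|l /kz ->];
    rewrite ?kj' ?mul1r ?mul0r.
pose f i := sval (cid (simple i)).
have fE i : aff_act x (asimple i) = asimple (f i) by exact: svalP (cid (simple i)).
have f_inj : injective f.
  move=> i j E; have : asimple i = asimple j.
    by rewrite -(aff_actK x (asimple i)) fE E -fE aff_actK.
  move/(congr1 (kap D i)); rewrite !kap_asimple eqxx.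
  by case: eqP => // _ /eqP; rewrite oner_eq0.
by exists (perm f_inj) => i; rewrite permE.
Qed.

Lemma in_ZP x : in_Z x <-> forall b, ht D (aff_act x b) = ht D b.
Proof.
split=> [xZ b|h]; first exact: in_Z_ht.
by apply: N0_in_Z; apply/eqP/N_eq0P => b _; rewrite /apos h.
Qed.

Lemma in_Z_mul x y : in_Z x -> in_Z y -> in_Z (x * y)%g.
Proof. by move=> /in_ZP hx /in_ZP hy; apply/in_ZP => b; rewrite aff_actM hx hy. Qed.

Lemma in_Z_inv x : in_Z x -> in_Z x^-1%g.
Proof. by move=> /in_ZP hx; apply/in_ZP => b; rewrite -[in RHS](aff_actVK x b) hx. Qed.

Lemma perm_inversions_Z t x : in_Z t -> perm_eq (inversions (t * x)%g) (inversions x).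
Proof.
move=> tZ; apply: uniq_perm; rewrite ?inv_uniq // => b.
by rewrite !mem_inv aff_actM in_Z_apos.
Qed.

Lemma N_in_Zl t x : in_Z t -> N (t * x)%g = N x.
Proof. by move=> /(perm_inversions_Z x)/perm_size. Qed.

Lemma N_in_Z t : in_Z t -> N t = 0%N.
Proof. by move=> tZ; apply/eqP/N_eq0P => b _; rewrite in_Z_apos. Qed.

Lemma ex_descent x : N x != 0%N -> exists i, ~~ apos D (aff_act x (asimple i)).
Proof.
move=> Nx; apply/existsP; apply: contraR Nx; rewrite negb_exists => /forallP px.
apply/N_eq0P => b Rb pb; rewrite /apos ht_act.
have kN := apos_kap Rb pb.
have le1 i : 1 <= ht D (aff_act x (asimple i)).
  by rewrite apos_ge1 ?aff_act_aroot ?asimple_aroot //; have := px i; rewrite negbK.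
apply: lt_le_trans pb _; apply: ler_sum => i _.
by rewrite -[leLHS]mulr1 ler_wpM2l.
Qed.

(** Right multiplication by a simple reflection whose root is made negative
  removes one inversion; what is left at the end has length zero. *)
Lemma Z_word x : exists t u, [/\ in_Z t, x = (t * val u)%g & size u = N x].
Proof.
have [n] := ubnP (N x); elim: n x => // n IH x; rewrite ltnS => Nx.
have [N0|N0] := eqVneq (N x) 0%N.
  exists x, [::]; rewrite /word_prod big_nil mulg1 N0.
  by split=> //; exact: N0_in_Z.
have [i /N_mulrV Ni] := ex_descent N0.
have [|t [u [tZ E S]]] := IH (x * s_ i)%g; first by rewrite Ni in Nx.
exists t, (rcons u i); rewrite word_prod_rcons mulgA -E -mulgA aff_refl_sqr mulg1.
by rewrite size_rcons S Ni.
Qed.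

(** A shortest word for an element of length zero is empty: otherwise its last
  letter would be an inversion of what precedes it, and could be cancelled
  against an earlier letter. *)
Lemma word_N0 u : N (val u) = 0%N -> val u = 1%g.
Proof.
have [n] := ubnP (size u); elim: n u => // n IH u.
case/lastP: u => [|u i]; first by rewrite /word_prod big_nil.
rewrite size_rcons !ltnS word_prod_rcons => Su N0.
have Ri := asimple_aroot D i.
have : asimple i \in inversions (val u).
  rewrite mem_inv Ri asimple_apos /=.
  have /eqP/N_eq0P/(_ _ Ri (asimple_apos D i)) := N0.
  by rewrite aff_actM aff_refl_self act_opp apos_opp ?aff_act_aroot.
case/inv_dels/mapP=> q /delsP[_ Sq E] Eq; rewrite aff_refl_arefl Eq -E.
by apply: IH; [rewrite Sq; exact: ltnW | rewrite E -Eq -aff_refl_arefl].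
Qed.

Lemma word_prod_cat u u' : val (u ++ u') = (val u * val u')%g.
Proof. by rewrite /word_prod big_cat. Qed.

Lemma word_prod_rev u : val (rev u) = (val u)^-1%g.
Proof.
elim: u => [|i u IH]; first by rewrite /word_prod !big_nil invg1.
rewrite rev_cons word_prod_rcons IH /word_prod big_cons invMg.
by congr (_ * _)%g; apply: (mulgI (s_ i)); rewrite mulgV aff_refl_sqr.
Qed.

Lemma word_reduced u : exists2 u', val u' = val u & size u' = N (val u).
Proof.
have [t [u' [tZ E S]]] := Z_word (val u); exists u' => //.
have tE : t = val (u ++ rev u') by rewrite word_prod_cat word_prod_rev E mulgK.
have : N t = 0%N by exact: N_in_Z.
by rewrite {1}tE => /word_N0; rewrite -tE => t1; rewrite E t1 mul1g.
Qed.

Lemma redwordP u : val (redword (val u)) = val u /\ size (redword (val u)) = N (val u).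
Proof.
rewrite /redword; case: classical_sets.xgetP => [u' _ [E min]|/(_ (sval (cid2 (word_reduced u))))].
  split=> //; have [u2 E2 S2] := word_reduced u.
  by apply/eqP; rewrite eqn_leq -{2}E N_le_size andbT -S2 min.
by case: cid2 => u' /= E S []; split=> // u2 E2; rewrite S -E2; exact: N_le_size.
Qed.

(** * Affine reflections are words *)

(** Some simple root [alpha_i] becomes negative under [arefl b]; unless
  [b = alpha_i], conjugating by [s_i] gives a reflection with fewer inversions. *)
Lemma arefl_word b : is_aroot D b -> exists u, arefl b = val u.
Proof.
have [n] := ubnP (N (arefl b)); elim: n b => // n IH b; rewrite ltnS => Nb Rb.
wlog pb : b Nb Rb / apos D b.
  move=> W; case pb: (apos D b); first exact: W.
  have [] := W (- b.1, - b.2); rewrite ?arefl_opp ?aroot_opp ?apos_opp ?pb //.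
  by move=> u ->; exists u.
have /ex_descent[i ni] : N (arefl b) != 0%N.
  by apply/negP => /N_eq0P/(_ b Rb pb); rewrite arefl_self // apos_opp // pb.
have Ri := asimple_aroot D i.
have [->|bi] := eqVneq b (asimple i).
  by exists [:: i]; rewrite -aff_refl_arefl /word_prod big_seq1.
set b' := aff_act (s_ i) b; have Rb' : is_aroot D b' by exact: aff_act_aroot.
have E : arefl b' = (s_ i * (arefl b * s_ i))%g.
  by rewrite aff_refl_arefl_conj // mulgA aff_refl_sqr mul1g.
have ni' : ~~ apos D (aff_act (s_ i) (aff_act (arefl b) (asimple i))).
  set c := aff_act (arefl b) _ in ni *; have Rc : is_aroot D c by exact: aff_act_aroot.
  rewrite -[aff_act _ _]/(aff_act (s_ i) c).
  have [cE|ci] := eqVneq c (- (asimple i).1, - (asimple i).2); last first.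
    rewrite -apos_opp ?aff_act_aroot // -act_opp; apply: aff_refl_apos.
    - exact: aroot_opp.
    - by rewrite apos_opp.
    - apply: contraNneq ci => <-; rewrite !opprK; exact/eqP/surjective_pairing.
  (* 2 alpha_i is a multiple of b, so b = alpha_i *)
  case/eqP: bi; move: cE; rewrite /c act_arefl // /asub => -[].
  set k := pairing _ _ => E1 E2.
  have k0 : k != 0.
    apply: contraTneq ni => k0; rewrite /c act_arefl // -/k k0 /asub scale0r subr0 mul0r subr0.
    by rewrite -surjective_pairing asimple_apos.
  have b1 : b.1 = (2 / k) *: (asimple i).1.
    apply: (scalerI k0); rewrite scalerA mulrCA divff // mulr1.
    by move/eqP: E1; rewrite subr_eq addrC -subr_eq opprK -mulr2n -scaler_nat => /eqP <-.
  have b2 : b.2 = (2 / k) * (asimple i).2.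
    by apply: (mulfI k0); rewrite mulrA mulrCA divff // mulr1; lra.
  have /andP[Ra _] := Rb; have /andP[Ra' _] := Ri.
  rewrite b1 in Ra; have [k1|k1] := roots_reduced Ra' Ra.
    by rewrite k1 scale1r mul1r in b1 b2; rewrite [b]surjective_pairing b1 b2 -surjective_pairing.
  move: pb; rewrite [b]surjective_pairing b1 b2 k1 scaleN1r mulN1r apos_opp //.
  by rewrite asimple_apos.
have NE : (N (arefl b') <= N (arefl b * s_ i)%g)%N.
  rewrite E; apply: uniq_leq_size; first exact: inv_uniq.
  move=> c; rewrite !mem_inv => /and3P[Rc pc nc]; rewrite Rc pc /=.
  set y := (arefl b * s_ i)%g in nc *.
  apply: contraNN nc => pyc; rewrite aff_actM; apply: aff_refl_apos => //.
    exact: aff_act_aroot.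
  apply: contraNneq ni' => ycE; rewrite -ycE /y aff_actM -[X in aff_act (s_ i) X]aff_actM.
  by rewrite arefl_sqr // aff_act1 aff_reflK.
have [|u uE] := IH b' _ Rb'.
  by apply: leq_ltn_trans NE _; rewrite -(N_mulrV ni).
exists (i :: rcons u i); rewrite -cat1s -cats1 !word_prod_cat.
rewrite /word_prod !big_seq1 -/(val u) -uE E !mulgA aff_refl_sqr mul1g.
by rewrite -mulgA aff_refl_sqr mulg1.
Qed.

End Inversions.
Arguments arefl {r D} b : simpl never.

(** * The affine Weyl group *)

Section AffineWeylGroup.
Variables (r : nat) (D : root_system r).
Implicit Types (x y : extaff D) (l m : coweight D) (w : weyl D).
Local Notation val u := (word_prod D u).

Lemma mul_trans x y : coweight_row (trans_part (x * y)%g) =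
  coweight_row (trans_part x) + coweight_row (trans_part y) *m invmx (weyl_mx (weyl_part x)).
Proof. by []. Qed.

Lemma mul_weyl x y :
  weyl_mx (weyl_part (x * y)%g) = weyl_mx (weyl_part x) *m weyl_mx (weyl_part y).
Proof. by []. Qed.

Definition is_word x := exists u, x = val u.

Lemma is_word1 : is_word 1%g.
Proof. by exists [::]; rewrite /word_prod big_nil. Qed.

Lemma is_wordM x y : is_word x -> is_word y -> is_word (x * y)%g.
Proof. by move=> [u ->] [u' ->]; exists (u ++ u'); rewrite word_prod_cat. Qed.

Lemma is_wordV x : is_word x -> is_word x^-1%g.
Proof. by move=> [u ->]; exists (rev u); rewrite word_prod_rev. Qed.

Lemma translD l m : transl (l + m) = (transl l * transl m)%g.
Proof. by apply: extaff_ext; rewrite /= ?invmx1 ?mulmx1. Qed.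

Lemma translN l : transl (- l) = (transl l)^-1%g.
Proof. by apply: (mulgI (transl l)); rewrite -translD subrr mulgV. Qed.

Lemma is_word_coroot a (Ra : a \in roots D) : is_word (transl (ccoroot Ra)).
Proof.
have R n : n \is a Num.int -> is_aroot D (a, n) by move=> nZ; rewrite /is_aroot Ra.
have R0 : is_aroot D (a, 0) by apply: R; exact: rpred0.
have R1 : is_aroot D (a, -1) by apply: R; rewrite rpredN rpred1.
have -> : transl (ccoroot Ra) = (arefl (a, -1) * arefl (a, 0))%g.
  apply: extaff_ext; last by rewrite mul_weyl !arefl_weyl // refl_mxK.
  by rewrite mul_trans !arefl_trans //= oppr0 scale0r mul0mx addr0 opprK scale1r.
by apply: is_wordM; exact: arefl_word.
Qed.

Lemma is_word_of_weyl w : is_word (of_weyl w).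
Proof.
have [s sR] := weylP w; elim: s w sR => [|a s IH] w sR E.
  have -> : of_weyl w = 1%g by apply: extaff_ext; rewrite /= ?E ?big_nil.
  exact: is_word1.
have Ra : a \in roots D by apply: sR; rewrite inE eqxx.
have R0 : is_aroot D (a, 0) by rewrite /is_aroot Ra rpred0.
have -> : of_weyl w = (arefl (a, 0) * of_weyl ((wrefl Ra)^-1 * w)%g)%g.
  apply: extaff_ext.
    by rewrite mul_trans arefl_trans //= oppr0 scale0r mul0mx addr0.
  by rewrite mul_weyl arefl_weyl //= mulKVmx // (weyl_unit (wrefl Ra)).
apply: is_wordM; first exact: arefl_word.
apply: IH; first by move=> b bs; apply: sR; rewrite inE bs orbT.
by rewrite /= E big_cons mulKmx // (weyl_unit (wrefl Ra)).
Qed.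

(** A translation by a coroot is a product of two parallel affine reflections,
  and these are words. *)
Lemma in_Waff_word x : in_Waff x -> is_word x.
Proof.
case: x => l w [c] /= lE.
have -> : ExtAff l w = (transl l * of_weyl w)%g.
  by apply: extaff_ext; rewrite /= ?mul0mx ?addr0 ?mul1mx.
apply: is_wordM (is_word_of_weyl w).
pose cc a : coweight D := insubd 0 (coroot D a).
have -> : l = \sum_(a <- roots D | a \in roots D) cc a *~ c a.
  apply: val_inj; rewrite raddf_sum -big_seq /= lE big_seq [RHS]big_seq.
  apply: eq_bigr => a Ra.
  rewrite -[RHS]/(\val (cc a *~ c a)) raddfMz /=.
  by rewrite (insubdK _ (ccoroot_subproof Ra)).
elim/big_ind: _ => [|l1 l2 W1 W2|a Ra].
- exact: is_word1.
- by rewrite translD; exact: is_wordM.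
have Wc : is_word (transl (cc a)).
  have -> : cc a = ccoroot Ra.
    by apply: val_inj; rewrite /= (insubdK _ (ccoroot_subproof Ra)).
  exact: is_word_coroot.
have Wn n : is_word (transl (cc a *+ n)).
  elim: n => [|n IH]; first exact: is_word1.
  by rewrite mulrS translD; exact: is_wordM.
case: (c a) => n; first exact: Wn.
by rewrite NegzE mulrNz translN; exact/is_wordV/Wn.
Qed.

(** A word of length zero is trivial, so that [Z] meets [W_aff] trivially. *)
Lemma Zdecomp_uniq t t' y y' : in_Z t -> in_Z t' -> is_word y -> is_word y' ->
  (t * y)%g = (t' * y')%g -> t = t' /\ y = y'.
Proof.
move=> tZ tZ' Wy Wy' E.
have E' : (t'^-1 * t)%g = (y' * y^-1)%g.
  by apply: (mulgI t'); rewrite mulKVg mulgA -E mulgK.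
have [u uE] : is_word (y' * y^-1)%g by exact/is_wordM/is_wordV.
have N0 : N (y' * y^-1)%g = 0%N by rewrite -E'; apply/N_in_Z/in_Z_mul/tZ/in_Z_inv.
have : (y' * y^-1)%g = 1%g by move: N0; rewrite uE => /word_N0.
move=> y1; have yE : y = y' by rewrite -[y']mulg1 -(mulVg y) mulgA y1 mul1g.
by split=> //; move: E; rewrite yE => /mulIg.
Qed.

End AffineWeylGroup.

(** * The nil-Hecke relation in the crossed product *)

Section CrossedProductCoefficients.
Variables (G : groupType) (F : comNzRingType) (act : G -> {rmorphism F -> F}).
Hypothesis act1 : forall f, act 1%g f = f.
Implicit Types (x y : G) (g h : {malg F[G]}) (f : F).
Local Notation "g *c h" := (crossed_mul act g h) (at level 40).
Local Notation cf g x := (monalg.mcoeff x g).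

Lemma crossed_coef_suml g h x : cf (g *c h) x =
  \sum_(y <- monalg.msupp g) cf (<< cf g y *g y >> *c h) x.
Proof. by rewrite {1}(monalg.monalgE g) crossed_mul_suml raddf_sum. Qed.

Lemma crossed_coef_sumr g h x : cf (g *c h) x =
  \sum_(y <- monalg.msupp h) cf (g *c << cf h y *g y >>) x.
Proof. by rewrite {1}(monalg.monalgE h) crossed_mul_sumr raddf_sum. Qed.

Lemma coef_sum g x : cf g x = \sum_(y <- monalg.msupp g) cf g y *+ (y == x).
Proof.
rewrite {1}(monalg.monalgE g) raddf_sum.
by apply: eq_bigr => y _ /=; rewrite mcoeffU.
Qed.

Lemma crossed_coef_scal f g x : cf (<< f *g 1%g >> *c g) x = f * cf g x.
Proof.
rewrite crossed_coef_sumr [in RHS](coef_sum g x) mulr_sumr; apply: eq_bigr => y _.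
by rewrite crossed_mulUU mcoeffU mul1g act1 mulrnAr.
Qed.

Lemma crossed_coef_scalr f g x : cf (g *c << f *g 1%g >>) x = cf g x * act x f.
Proof.
rewrite crossed_coef_suml [in RHS](coef_sum g x) mulr_suml; apply: eq_bigr => y _.
rewrite crossed_mulUU mcoeffU mulg1.
by case: eqP => [->|]; rewrite ?mulr1n // !mulr0n mul0r.
Qed.

Lemma crossed_coef_delta y g x : cf (g *c << 1 *g y >>) x = cf g (x * y^-1)%g.
Proof.
rewrite crossed_coef_suml [in RHS](coef_sum g); apply: eq_bigr => z _.
rewrite crossed_mulUU mcoeffU rmorph1 mulr1.
congr (_ *+ nat_of_bool _); apply/eqP/eqP => [<-|->]; last by rewrite mulgKV.
by rewrite mulgK.
Qed.

Lemma crossed_delta_scal x f :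
  << 1 *g x >> *c << f *g 1%g >> = << act x f *g 1%g >> *c << 1 *g x >>.
Proof. by rewrite !crossed_mulUU mul1r mul1g mulg1 act1 mulr1. Qed.

Lemma crossed_deltaM x y : << 1 *g x >> *c << 1 *g y >> = << 1 *g (x * y)%g >>.
Proof. by rewrite crossed_mulUU rmorph1 mulr1. Qed.

Lemma crossed_scalM f f' : << f *g 1%g >> *c << f' *g 1%g >> = << f * f' *g 1%g >>.
Proof. by rewrite crossed_mulUU mulg1 act1. Qed.

Lemma crossed_fixed f : (forall x, act x f = f) ->
  forall g, g *c << f *g 1%g >> = << f *g 1%g >> *c g.
Proof.
move=> fixf g; apply/malgP => x.
by rewrite crossed_coef_scalr crossed_coef_scal fixf mulrC.
Qed.

End CrossedProductCoefficients.

Lemma mulVMf (K : fieldType) (a b : K) : a != 0 -> a^-1 * (b * a) = b.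
Proof. by move=> nz; rewrite mulrCA mulVf ?mulr1. Qed.

Section NilHeckeRelation.
Variables (r : nat) (D : root_system r).
Local Notation SymV := (mpoly.mpoly r rat).
Local Notation F := {fraction (mpoly.mpoly r rat)}.
Local Notation Q := (Qaff D).
Implicit Types (x y : extaff D) (g : Q) (f : F) (v : 'cV[rat]_r).
Local Notation qs := (@qscal r D).

Definition cf (g : Q) x : F := monalg.mcoeff x (g : {malg F[extaff D]}).

Lemma Qext g g' : (forall x, cf g x = cf g' x) -> g = g'.
Proof. by move=> E; apply/malgP. Qed.

Lemma cfD g g' x : cf (g + g') x = cf g x + cf g' x. Proof. exact: mcoeffD. Qed.
Lemma cf0 x : cf 0 x = 0. Proof. exact: mcoeff0. Qed.
Lemma cf_sum (I : Type) (s : seq I) (P : pred I) (G : I -> Q) x :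
  cf (\sum_(i <- s | P i) G i) x = \sum_(i <- s | P i) cf (G i) x.
Proof. exact: (big_morph (cf^~ x) (fun g g' => cfD g g' x) (cf0 x)). Qed.

Lemma cf_qscalM f g x : cf (qs f * g) x = f * cf g x.
Proof. exact: (crossed_coef_scal (@wfrac1 r D)). Qed.

Lemma cf_Mqscal f g x : cf (g * qs f) x = cf g x * wfrac x f.
Proof. exact: (crossed_coef_scalr (@wfrac r D)). Qed.

Lemma cf_Mdelta y g x : cf (g * delta y) x = cf g (x * y^-1)%g.
Proof. exact: (crossed_coef_delta (@wfrac r D)). Qed.

Lemma deltaM x y : delta x * delta y = delta (x * y)%g.
Proof. exact: (crossed_deltaM (@wfrac r D)). Qed.

Lemma qscalM f f' : qs f * qs f' = qs (f * f').
Proof. exact: (crossed_scalM (@wfrac1 r D)). Qed.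

Lemma qscalC f f' : qs f * qs f' = qs f' * qs f.
Proof. exact: etrans (qscalM f f') (etrans (congr1 qs (mulrC f f')) (esym (qscalM f' f))). Qed.

Lemma qscalVM f f' : f != 0 -> qs f^-1 * qs (f' * f) = qs f'.
Proof. by move=> nz; exact: etrans (qscalM _ _) (congr1 qs (mulVMf f' nz)). Qed.

Lemma qscalD f f' : qs (f + f') = qs f + qs f'.
Proof. exact: monalgUD. Qed.

Lemma qscalN f : qs (- f) = - qs f.
Proof. exact: monalgUN. Qed.

Lemma delta_qscal x f : delta x * qs f = qs (wfrac x f) * delta x.
Proof. exact: (crossed_delta_scal (@wfrac1 r D)). Qed.

(** Elements of [V] and rational constants, as elements of [Frac S] and of the
  crossed product. *)
Definition lin v : F := FracField.tofrac (linform v).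
Definition qlin v : Q := qs (lin v).
Definition qcst (c : rat) : Q := qs (FracField.tofrac c%:MP_[r]).

Lemma linformB u v : linform (u - v) = linform u - linform v :> SymV.
Proof.
by rewrite /linform -sumrB; apply: eq_bigr => i _; rewrite !mxE scalerBl.
Qed.

Lemma linformZ (c : rat) v : linform (c *: v) = c%:MP_[r] * linform v :> SymV.
Proof.
rewrite mul_mpolyC /linform scaler_sumr; apply: eq_bigr => i _.
by rewrite mxE scalerA.
Qed.

Lemma linform_inj : injective (@linform r).
Proof.
move=> u v E; apply/matrixP => i j; rewrite ord1.
have coef (w : 'cV[rat]_r) : mpoly.mcoeff U_(i)%MM (linform w) = w i 0.
  rewrite /linform raddf_sum /= (bigD1 i) //= big1 ?addr0 => [|k ki].
    by rewrite mpoly.mcoeffZ mpoly.mcoeffX eqxx mulr1.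
  by rewrite mpoly.mcoeffZ mpoly.mcoeffX eq_mnm1 (negbTE ki) mulr0.
by rewrite -coef E coef.
Qed.

Lemma lin_inj : injective lin.
Proof. by move=> u v /eqP; rewrite tofrac_eq => /eqP/linform_inj. Qed.

Lemma linN v : lin (- v) = - lin v.
Proof.
rewrite /lin -[in RHS]tofracN; congr tofrac.
by rewrite -scaleN1r linformZ mpolyCN mpolyC1 mulN1r.
Qed.

Lemma lin_neq0 v : v != 0 -> lin v != 0.
Proof.
have l0 : lin 0 = 0.
  by rewrite /lin -(subrr 0) linformB subrr tofrac0.
by apply: contra_neq => E; apply: lin_inj; rewrite E l0.
Qed.

Lemma wfrac_lin x v : wfrac x (lin v) = lin (weyl_mx (weyl_part x) *m v).
Proof.
rewrite /wfrac (fracmap_tofrac (@wpoly_inj r D (weyl_part x))).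
by congr FracField.tofrac; exact: wpoly_linform.
Qed.

Lemma wfrac_cst x (c : rat) :
  wfrac x (FracField.tofrac c%:MP_[r]) = FracField.tofrac c%:MP_[r].
Proof.
rewrite /wfrac (fracmap_tofrac (@wpoly_inj r D (weyl_part x))).
by congr FracField.tofrac; exact: wpolyC.
Qed.

Lemma qcst_comm c g : g * qcst c = qcst c * g.
Proof. by apply: (crossed_fixed (@wfrac1 r D)) => x; exact: wfrac_cst. Qed.

Lemma qcstN c : qcst (- c) = - qcst c.
Proof. by rewrite /qcst mpolyCN tofracN qscalN. Qed.

Lemma delta_qlin x v : delta x * qlin v = qlin (weyl_mx (weyl_part x) *m v) * delta x.
Proof. have := delta_qscal x (lin v); rewrite wfrac_lin; exact. Qed.

Lemma qlin_refl a u v k : u = v - k *: a ->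
  qlin u = qlin v - qs (FracField.tofrac k%:MP_[r] * lin a).
Proof.
by move=> ->; rewrite /qlin /lin linformB linformZ tofracB tofracM qscalD qscalN.
Qed.

Lemma ring_nil_hecke (R : nzRingType) (b d q q' c ca : R) :
  d * q = q' * d -> q = q' + ca -> b * q' = q' * b -> b * ca = c ->
  b * (1 - d) * q = q' * (b * (1 - d)) + c.
Proof.
move=> dq qE bq' <-; rewrite -mulrA mulrBl mul1r dq qE addrAC -[X in X - _]mulr1.
by rewrite -mulrBr mulrDr !mulrA bq'.
Qed.

(** [(v - s_i v) / alpha_i] is the constant [<alpha_i^v, v>]. *)
Lemma Agen_qlin i v : Agen D i * qlin v =
  qlin (weyl_mx (weyl_part (aff_refl D i)) *m v) * Agen D i
  + qcst (pairing (coroot D (aff_alpha D i).1) v).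
Proof.
have Ri := asimple_aroot D i; have /andP[Ra _] := Ri.
have nz : lin (aff_alpha D i).1 != 0 by apply: lin_neq0; exact: root_neq0 Ra.
have sE : weyl_mx (weyl_part (aff_refl D i)) *m v =
    v - pairing (coroot D (aff_alpha D i).1) v *: (aff_alpha D i).1.
  by rewrite aff_refl_arefl arefl_weyl // refl_mxE.
pose k := pairing (coroot D (aff_alpha D i).1) v.
apply: (ring_nil_hecke (delta_qlin (aff_refl D i) v)
  (ca := qs (FracField.tofrac k%:MP_[r] * lin (aff_alpha D i).1))).
- by rewrite (qlin_refl sE) subrK.
- exact: qscalC.
- exact: qscalVM.
Qed.

End NilHeckeRelation.

(** * Intertwiners and sums over point stabilisers *)

Section Separation.
Variables (r : nat) (D : root_system r).
Local Notation Q := (Qaff D).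
Implicit Types (x y : extaff D) (g : Q) (v : 'cV[rat]_r) (nu : 'rV[rat]_r) (w : weyl D).
Local Notation s_ := (aff_refl D).

Lemma weyl_ext w w' : (forall a, a \in roots D -> weyl_mx w *m a = weyl_mx w' *m a) -> w = w'.
Proof.
move=> E; apply: weyl_perm_inj; apply/ffunP => a; rewrite !ffunE.
by apply: val_inj => /=; apply: E; exact: valP.
Qed.

Lemma idomain_comm_eq (K : idomainType) (a b c : K) : c != 0 -> c * a = b * c -> a = b.
Proof. by move=> c0; rewrite mulrC => /(mulIf c0). Qed.

(** Comparison of the coefficients of [delta_x] gives [c_x x(a) = w(a) c_x] for
  every root [a], and the roots span. *)
Lemma intertwiner_support w g :
  (forall a, a \in roots D -> g * qlin D a = qlin D (weyl_mx w *m a) * g) ->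
  forall x, cf g x != 0 -> weyl_part x = w.
Proof.
move=> gw x gx; apply: weyl_ext => a Ra; apply: lin_inj.
apply: idomain_comm_eq gx _; rewrite -wfrac_lin.
have := congr1 (fun h => cf h x) (gw a Ra).
move/(etrans (esym (cf_Mqscal (lin a) g x))) => E.
exact: etrans E (cf_qscalM _ _ _).
Qed.

(** The extended affine Weyl group acts on rows by [t_l w nu = w nu + l]. Its
  element [stab_el nu w] with finite part [w] fixes [nu]; it exists when
  [nu - w nu] is a coweight. *)
Definition in_stab nu w := in_coweight D (nu - nu *m invmx (weyl_mx w)).
Definition stab_el nu w : extaff D :=
  ExtAff (insubd 0 (nu - nu *m invmx (weyl_mx w))) w.

(** The generators [A_i] for which [s_i] fixes [nu] kill this sum from the left,
  because [A_i] is a multiple of [1 - delta_(s_i)]. *)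
Definition stab_sum nu : Q := \sum_(w | in_stab nu w) delta (stab_el nu w).

Lemma stab_el1 nu : stab_el nu 1%g = 1%g.
Proof.
apply: extaff_ext; rewrite //= invmx1 mulmx1 subrr.
by rewrite [LHS](insubdK _ (rpred0 _)).
Qed.

Lemma stab_elE nu w : in_stab nu w ->
  coweight_row (trans_part (stab_el nu w)) = nu - nu *m invmx (weyl_mx w).
Proof. by move=> S; exact: (@insubdK _ _ (coweight D) 0 _ S). Qed.

Lemma cf_Mstab_sum nu g x : cf (g * stab_sum nu) x =
  \sum_(w | in_stab nu w) cf g (x * (stab_el nu w)^-1)%g.
Proof.
rewrite /stab_sum mulr_sumr cf_sum.
by apply: eq_bigr => w _; exact: cf_Mdelta.
Qed.

(** No cancellation takes place in the product: the terms of [g] differ by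
  translations on the left, and the stabiliser of a point contains no nontrivial
  translation. *)
Lemma intertwiner_stab_sum nu w g :
  (forall a, a \in roots D -> g * qlin D a = qlin D (weyl_mx w *m a) * g) ->
  g * stab_sum nu = 0 -> g = 0.
Proof.
move=> /intertwiner_support supp g0; apply: Qext => x.
have [->|gx] := eqVneq (cf g x) 0; first by rewrite cf0.
have := cf_Mstab_sum nu g x; rewrite g0 !cf0 (bigD1 1%g) /=; last first.
  by rewrite /in_stab /= invmx1 mulmx1 subrr; exact: rpred0.
rewrite big1 ?addr0 => [->|w' /andP[_ w'1]]; first by rewrite stab_el1 invg1 mulg1.
apply/eqP; apply: contraTT w'1 => /supp; rewrite -(supp x gx) /=.
by move/(canRL (mulKg _)); rewrite mulVg negbK => /eqP; rewrite eq_invg1.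
Qed.

(** The affine root [alpha_i] vanishes at [nu], that is, [s_i] fixes [nu]. *)
Definition fixes_point nu i := pairing nu (aff_alpha D i).1 + (aff_alpha D i).2 == 0.

Lemma aff_refl_stab_el nu i w : fixes_point nu i -> in_stab nu w ->
  in_stab nu (weyl_part (s_ i) * w)%g /\
  (s_ i * stab_el nu w)%g = stab_el nu (weyl_part (s_ i) * w)%g.
Proof.
move=> /eqP fixi Sw; have Ri := asimple_aroot D i; have /andP[Ra _] := Ri.
have sinv : invmx (weyl_mx (weyl_part (s_ i))) = refl_mx D (aff_alpha D i).1.
  rewrite aff_refl_arefl arefl_weyl // -[LHS]mul1mx -(refl_mxK Ra) mulmxK //.
  by have := weyl_unit (wrefl Ra).
have E : coweight_row (trans_part (s_ i * stab_el nu w : extaff D)%g)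
    = nu - nu *m invmx (weyl_mx (weyl_part (s_ i) * w : weyl D)%g).
  have -> : invmx (weyl_mx (weyl_part (s_ i) * w : weyl D)%g)
      = invmx (weyl_mx w) *m invmx (weyl_mx (weyl_part (s_ i))).
    exact: (congr1 (@weyl_mx _ _) (invMg (weyl_part (s_ i)) w)).
  rewrite mul_trans stab_elE // sinv aff_refl_arefl arefl_trans // mulmxBl mulmxA.
  rewrite addrA; congr (_ - _).
  rewrite /refl_mx mulmxBr mulmx1 mulmxA.
  have -> : nu *m (aff_alpha D i).1 = (pairing nu (aff_alpha D i).1)%:M.
    by apply/matrixP => p q; rewrite !ord1 [RHS]mxE eqxx.
  rewrite mul_scalar_mx addrCA -scaleNr -scalerDl -opprD [X in - X]addrC fixi.
  by rewrite oppr0 scale0r addr0.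
have Sw' : in_stab nu (weyl_part (s_ i) * w)%g.
  by rewrite /in_stab -E; exact: valP.
by split=> //; apply: extaff_ext => //; rewrite E stab_elE.
Qed.

Lemma delta_stab_sum nu i : fixes_point nu i -> delta (s_ i) * stab_sum nu = stab_sum nu.
Proof.
move=> fixi; pose s : weyl D := weyl_part (s_ i).
have ss : (s * s)%g = 1%g.
  by have /(congr1 (@weyl_part _ _)) := aff_refl_sqr D i.
have P w : in_stab nu (s * w)%g = in_stab nu w.
  apply/idP/idP => [S|/(aff_refl_stab_el fixi)[]//].
  by have [] := aff_refl_stab_el fixi S; rewrite -/s mulgA ss mul1g.
rewrite /stab_sum mulr_sumr [RHS](reindex_inj (mulgI s)) /=.
rewrite (eq_bigl _ _ P); apply: eq_bigr => w Sw.
by rewrite [LHS]deltaM (aff_refl_stab_el fixi Sw).2.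
Qed.

Lemma ring_kill (R : nzRingType) (b d e : R) : d * e = e -> b * (1 - d) * e = 0.
Proof. by move=> de; rewrite -mulrA mulrBl mul1r de subrr mulr0. Qed.

Lemma ring_fix (R : nzRingType) (b d : R) :
  d * b = - b * d -> d * d = 1 -> d * (b * (1 - d)) = b * (1 - d).
Proof.
by move=> db dd; rewrite mulrA db -mulrA mulrBr mulr1 dd mulNr -mulrN opprB.
Qed.

Lemma Agen_stab_sum nu i : fixes_point nu i -> Agen D i * stab_sum nu = 0.
Proof. by move=> /delta_stab_sum; exact: ring_kill. Qed.

Lemma Agen_sqr i : Agen D i * Agen D i = 0.
Proof.
apply: ring_kill; apply: ring_fix; last first.
  exact: etrans (deltaM _ _) (congr1 (@delta r D) (aff_refl_sqr D i)).
have sE : weyl_mx (weyl_part (s_ i)) *m (aff_alpha D i).1 = - (aff_alpha D i).1.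
  by have /(congr1 fst) := aff_refl_self D i.
have lE : wfrac (s_ i) (lin (aff_alpha D i).1) = - lin (aff_alpha D i).1.
  by apply: etrans (wfrac_lin _ _) _; rewrite sE linN.
have E : wfrac (s_ i) (lin (aff_alpha D i).1)^-1 = - (lin (aff_alpha D i).1)^-1.
  exact: etrans (fmorphV _ _) (etrans (congr1 GRing.inv lE) (invrN _)).
apply: etrans (delta_qscal _ _) _.
exact: (congr1 (fun g => g * delta (s_ i)) (etrans (congr1 (qscal D) E) (qscalN D _))).
Qed.

End Separation.

(** * Independence of reduced words *)

Section CommonFixedPoint.
Variables (r : nat) (D : root_system r).
Implicit Types (x y : extaff D) (v : 'cV[rat]_r) (nu : 'rV[rat]_r).

(** The coordinate form [om k] as a point of the coweight space, i.e. a
  fundamental coweight. *)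
Definition om_row k : 'rV[rat]_r := \row_p om D k (delta_mx p 0).

Lemma pairing_om_row k v : pairing (om_row k) v = om D k v.
Proof.
rewrite [in RHS](matrix_sum_delta v) /pairing mxE om_sumr; apply: eq_bigr => p _.
by rewrite big_ord1 omZ !mxE mulrC.
Qed.

(** Otherwise [Theta] would be a multiple of [alpha_j]. *)
Lemma Theta_other_coord j : Theta D != alpha D j -> exists2 k, k != j & om D k (Theta D) != 0.
Proof.
move=> Tj; have [//|none] := pselect (exists2 k, k != j & om D k (Theta D) != 0).
have TE : Theta D = om D j (Theta D) *: alpha D j.
  rewrite {1}(om_sum D (Theta D)) (bigD1 j) //= big1 ?addr0 // => k kj.
  have [->|ok] := eqVneq (om D k (Theta D)) 0; first by rewrite scale0r.
  by case: none; exists k.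
have RT := Theta_root D; rewrite TE in RT.
have [c1|c1] := roots_reduced (alpha_root D j) RT.
  by case/eqP: Tj; rewrite TE c1 scale1r.
by have := om_Theta_ge0 D j; rewrite c1; lra.
Qed.

Lemma fixes_point0 nu : fixes_point D nu ord0 = (pairing nu (Theta D) == 1).
Proof. by rewrite /fixes_point asimple0 /= pairingNr addrC subr_eq0 eq_sym. Qed.

Lemma fixes_point_lift nu j : fixes_point D nu (lift ord0 j) = (pairing nu (alpha D j) == 0).
Proof. by rewrite /fixes_point asimple_lift /= addr0. Qed.

Lemma mixed_fixed_point x j : ~~ apos D (aff_act x (aff_alpha D ord0)) ->
  ~~ apos D (aff_act x (aff_alpha D (lift ord0 j))) ->
  exists nu, fixes_point D nu ord0 && fixes_point D nu (lift ord0 j).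
Proof.
have [TE|/Theta_other_coord[k kj k0]] := eqVneq (Theta D) (alpha D j); last first.
  move=> _ _; exists ((om D k (Theta D))^-1 *: om_row k).
  rewrite fixes_point0 fixes_point_lift !pairingZl !pairing_om_row om_alpha.
  by rewrite (negbTE kj) mulr0 mulVf // !eqxx.
have E : aff_alpha D ord0 = asub (0, 1) 1 (aff_alpha D (lift ord0 j)).
  by rewrite asimple0 asimple_lift /asub /= TE sub0r scale1r mulr0 subr0.
rewrite E aff_act_sub /apos ht_sub mul1r.
have -> : aff_act x (0, 1) = (0, 1) by rewrite /aff_act /= mulmx0 pairing0r subr0.
have : 1 <= ht D (0, 1).
  rewrite /ht big_ord_recl kap0 /= lerDl sumr_ge0 // => k _.
  have om0 : om D k 0 = 0 by exact: linear0.
  by rewrite kap_lift /= om0 add0r mul1r om_Theta_ge0.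
move: (ht _ _) (ht _ _) => p q; lra.
Qed.

(** Two finite simple reflections fix the origin. The vanishing of [alpha_0] and
  that of [alpha_j] are compatible conditions unless [alpha_j = Theta]; in that
  case [alpha_0 + alpha_j] is the null root, which [x] fixes, and [x] cannot make
  both of them negative. *)
Lemma common_fixed_point x i j : ~~ apos D (aff_act x (aff_alpha D i)) ->
  ~~ apos D (aff_act x (aff_alpha D j)) ->
  exists nu, fixes_point D nu i && fixes_point D nu j.
Proof.
case: (unliftP ord0 i) => [i'|] ->; case: (unliftP ord0 j) => [j'|] ->.
- by move=> _ _; exists 0; rewrite !fixes_point_lift !pairing0l eqxx.
- by move=> n1 n2; have [nu] := mixed_fixed_point n2 n1; exists nu; rewrite andbC.
- exact: mixed_fixed_point.
- move=> _ _; exists (2^-1 *: coroot D (Theta D)).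
  by rewrite fixes_point0 pairingZl coroot_root ?Theta_root // mulVf ?eqxx.
Qed.

End CommonFixedPoint.

(** The argument uses only the following formal properties of the crossed
  product: [ql] and [qc] stand for linear forms and constants, and [e nu] for the
  sum over the stabiliser of [nu]. *)
Section NilHeckeWords.
Variables (r : nat) (D : root_system r).
Local Notation V := 'cV[rat]_r.
Variables (Q : nzRingType) (ql : V -> Q) (qc : rat -> Q) (A : 'I_r.+1 -> Q).
Variable e : 'rV[rat]_r -> Q.
Implicit Types (x y : extaff D) (v : V) (nu : 'rV[rat]_r) (u : seq 'I_r.+1) (g : Q).
Local Notation val u := (word_prod D u).
Local Notation s_ := (aff_refl D).
Local Notation wt x := (weyl_mx (weyl_part x)).

Hypothesis A_ql : forall i v, A i * ql v =
  ql (wt (s_ i) *m v) * A i + qc (pairing (coroot D (aff_alpha D i).1) v).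
Hypothesis qc_comm : forall c g, g * qc c = qc c * g.
Hypothesis A_sqr : forall i, A i * A i = 0.
Hypothesis A_e : forall nu i, fixes_point D nu i -> A i * e nu = 0.
Hypothesis e_faithful : forall nu (w : weyl D) g,
  (forall a, a \in roots D -> g * ql a = ql (weyl_mx w *m a) * g) ->
  g * e nu = 0 -> g = 0.

Definition Aw u : Q := \prod_(i <- u) A i.

Lemma Aw_rcons u i : Aw (rcons u i) = Aw u * A i.
Proof. by rewrite /Aw big_rcons. Qed.

(** Moving a linear form across a word of generators: each letter in turn
  either passes it on or is deleted. *)
Lemma Aw_ql u v : Aw u * ql v = ql (wt (val u) *m v) * Aw u +
  \sum_(q <- dels D u) qc (pairing (coroot D q.1.1) v) * Aw q.2.
Proof.
elim/last_ind: u v => [|u i IH] v.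
  by rewrite /Aw /word_prod /dels /= !big_nil /= mul1mx mul1r mulr1 addr0.
rewrite Aw_rcons -mulrA A_ql mulrDr mulrA IH mulrDl -!addrA.
rewrite word_prod_rcons mul_weyl mulmxA !mulrA; congr (_ + _).
rewrite dels_rcons big_cons big_map /= qc_comm addrC; congr (_ + _).
rewrite mulr_suml !big_seq; apply: eq_bigr => q /delsP[/andP[Ra _] _ _].
rewrite -mulrA -Aw_rcons; congr (qc _ * _).
rewrite -(coroot_weyl (weyl_part (s_ i))) //.
rewrite mulmxA -mul_weyl.
by rewrite aff_refl_sqr /= mul1mx.
Qed.

Lemma Aw_ql_twist (t : extaff D) (d : Q) u v :
  (forall v', d * ql v' = ql (wt t *m v') * d) ->
  d * Aw u * ql v = ql (wt (t * val u)%g *m v) * (d * Aw u) +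
  \sum_(q <- dels D u) qc (pairing (coroot D q.1.1) v) * (d * Aw q.2).
Proof.
move=> dql; rewrite -mulrA Aw_ql mulrDr mulrA dql mulmxA -mul_weyl -mulrA.
congr (_ + _); rewrite mulr_sumr; apply: eq_bigr => q _.
by rewrite mulrA qc_comm mulrA.
Qed.

Definition Ad x : Q := Aw (redword x).

(** The expected product over a word of length [n] for [x]; this covers both the
  vanishing for non-reduced words and the independence of the reduced word, which
  need a common induction. *)
Definition word_value n x : Q := if N x == n then Ad x else 0.

Lemma Aw_ql_reduced n u v :
  (forall u', size u' = n -> Aw u' = word_value n (val u')) ->
  size u = n.+1 -> N (val u) = n.+1 ->
  Aw u * ql v = ql (wt (val u) *m v) * Aw u +
  \sum_(b <- inversions (val u)) qc (pairing (coroot D b.1) v) * word_value n (val u * arefl b)%g.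
Proof.
move=> IH Su Nu; rewrite Aw_ql; congr (_ + _).
rewrite [RHS](perm_big (map fst (dels D u))) /=; last by apply: perm_dels; rewrite Nu.
rewrite big_map !big_seq; apply: eq_bigr => q /delsP[_ Sq E].
by congr (_ * _); rewrite -E; apply: IH; rewrite Su in Sq; case: Sq.
Qed.

(** The difference [g] of the products over two reduced words for [x] intertwines
  linear forms as [x] does, because the correction terms are sums over the
  inversions of [x] and only involve shorter words. If the words end in [i] and
  [j], then [g] kills the stabiliser sum of a point fixed by [s_i] and [s_j]. *)
Lemma Aw_word_value u : Aw u = word_value (size u) (val u).
Proof.
have [n nE] : exists n, n = size u by exists (size u).
rewrite -nE; elim: n u nE => [|n IH] u Su.
  case: u Su => // _; have := redwordP D [::]; rewrite /word_value /Ad.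
  have -> : N (val [::]) = 0%N.
    by apply/eqP; rewrite -leqn0; exact: N_le_size.
  by case=> _ /size0nil ->.
case/lastP: u Su => // u i; rewrite size_rcons => -[Su].
have IHu := IH _ Su.
rewrite /word_value; case: ifP => [/eqP Nx|nred]; last first.
  (* A non-reduced word whose last letter shortens a reduced word for x: the
     latter can be replaced by one with the same last letter, and A_i A_i = 0. *)
  rewrite Aw_rcons IHu /word_value; case: ifP => [/eqP Nu|_]; last by rewrite mul0r.
  have ni : ~~ apos D (aff_act (val u) (aff_alpha D i)).
    apply: contraFN nred => /N_mulr; rewrite -word_prod_rcons => ->.
    by rewrite Nu.
  have := N_mulrV ni; rewrite -word_prod_rcons => Ni.
  have [vE Sv] := redwordP D (rcons u i); set v := redword _ in vE Sv.
  have vi : val (rcons v i) = val u.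
    by rewrite word_prod_rcons vE word_prod_rcons -mulgA aff_refl_sqr mulg1.
  have := IH (rcons v i); rewrite size_rcons Sv -Ni Nu => /(_ erefl).
  by rewrite vi /word_value Nu eqxx => <-; rewrite Aw_rcons -mulrA A_sqr mulr0.
have [vE Sv] := redwordP D (rcons u i).
rewrite /Ad; case/lastP: (redword _) vE Sv => [|v j] vE Sv.
  by rewrite Nx in Sv.
have Nv : N (val (rcons v j)) = n.+1 by rewrite vE.
have IHn u' : size u' = n -> Aw u' = word_value n (val u') by move=> S; exact: IH.
have last_neg u' k : N (val (rcons u' k)) = n.+1 -> size u' = n ->
    ~~ apos D (aff_act (val (rcons u' k)) (aff_alpha D k)).
  move=> Nk Sk; apply/negP => /N_mulr.
  rewrite word_prod_rcons -mulgA aff_refl_sqr mulg1 -word_prod_rcons Nk => Nu'.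
  by have := N_le_size D u'; rewrite Nu' Sk ltnNge leqnSn.
have Sv' : size v = n by move: Sv; rewrite size_rcons Nx => -[].
have ni := last_neg u i Nx (esym Su); have nj := last_neg v j Nv Sv'.
rewrite vE in nj; have [nu /andP[fi fj]] := common_fixed_point ni nj.
apply/eqP; rewrite -subr_eq0; apply/eqP.
apply: (e_faithful (nu := nu) (w := weyl_part (val (rcons u i)))) => [a Ra|].
  rewrite mulrBl mulrBr (Aw_ql_reduced _ IHn _ Nx) ?size_rcons -?Su //.
  rewrite (Aw_ql_reduced _ IHn _ Nv) ?size_rcons ?Sv' // vE.
  by rewrite opprD addrACA subrr addr0.
by rewrite mulrBl !Aw_rcons -!mulrA !A_e // !mulr0 subrr.
Qed.

End NilHeckeWords.

(** * Lengths of translations and stabilisers of antidominant coweights *)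

Section InversionCount.
Variables (r : nat) (D : root_system r).
Implicit Types (x y : extaff D) (l mu : coweight D) (w : weyl D) (a v : 'cV[rat]_r).
Local Notation R := (undup (roots D)).

Lemma perm_roots_weyl w : perm_eq (map (mulmx (weyl_mx w)) R) R.
Proof.
have inj : injective (mulmx (weyl_mx w) : 'cV[rat]_r -> 'cV[rat]_r).
  by apply: can_inj (mulmx (invmx (weyl_mx w))) _ => v; exact: weylK.
apply: uniq_perm; rewrite ?map_inj_uniq ?undup_uniq // => a; rewrite mem_undup.
apply/mapP/idP => [[b]|Ra]; first by rewrite mem_undup => Rb ->; exact: weyl_roots.
exists (invmx (weyl_mx w) *m a); last by rewrite weylVK.
by rewrite mem_undup; exact: (weyl_roots w^-1%g Ra).
Qed.

Lemma perm_roots_opp : perm_eq (map -%R R) R.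
Proof.
apply: uniq_perm; rewrite ?map_inj_uniq ?undup_uniq //; first exact: oppr_inj.
move=> a; rewrite mem_undup.
apply/mapP/idP => [[b]|Ra]; first by rewrite mem_undup => Rb ->; exact: root_opp.
by exists (- a); rewrite ?opprK // mem_undup root_opp.
Qed.

Lemma chi_opp a : a \in roots D -> chi D (- a) = (1 - chi D a)%N.
Proof.
move=> Ra; have fN : fht D (- a) = - fht D a.
  by rewrite /fht -sumrN; apply: eq_bigr => j _; rewrite omN.
by rewrite /chi fN oppr_lt0; have := fht_neq0 Ra; case: ltgtP.
Qed.

Lemma N_sum x : N x = (\sum_(a <- R) Num.truncn
   (pairing (trans_part x) (weyl_mx (weyl_part x) *m a)
    + (chi D (weyl_mx (weyl_part x) *m a))%:R - (chi D a)%:R))%N.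
Proof.
rewrite /N /inversions size_allpairs_dep sumnE big_map.
by apply: eq_bigr => a _; rewrite size_iota.
Qed.

Lemma N_transl l : N (transl l) = (\sum_(a <- R) Num.truncn (pairing l a))%N.
Proof.
by rewrite N_sum; apply: eq_bigr => a _; rewrite /= mul1mx addrK.
Qed.

Lemma pairing_wact w l v : pairing (wact w l) (weyl_mx w *m v) = pairing l v.
Proof. by rewrite /= pairingM weylK. Qed.

(** Both lengths are the sum of the positive values of the pairings with roots. *)
Lemma N_transl_wact w l : N (transl (wact w l)) = N (transl l).
Proof.
rewrite !N_transl -(perm_big _ (perm_roots_weyl w)) big_map.
by apply: eq_bigr => a _; rewrite pairing_wact.
Qed.

Lemma antidominant_pos mu a : antidominant mu -> a \in roots D -> chi D a = 0%N ->
  pairing mu a <= 0.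
Proof.
move=> amu Ra ca; rewrite {1}(om_sum D a) pairing_sumr sumr_le0 // => j _.
rewrite pairingZr mulr_ge0_le0 //.
have [/(_ j)/natr_ge0//|neg] := om_root Ra.
have : fht D a <= 0 by rewrite sumr_le0 // => k _; rewrite -oppr_ge0; exact: natr_ge0 (neg k).
by rewrite le_eqVlt (negbTE (fht_neq0 Ra)) /=; move: ca; rewrite /chi => /eqP; case: (_ < 0).
Qed.

Lemma antidominant_neg mu a : antidominant mu -> a \in roots D -> chi D a = 1%N ->
  0 <= pairing mu a.
Proof.
move=> amu Ra ca; rewrite -oppr_le0 -pairingNr antidominant_pos ?root_opp //.
by rewrite chi_opp // ca.
Qed.

(** The comparison holds root by root: where the pairing with [w a] contributes to
  the length of the translation, [w a] is negative. *)
Lemma N_transl_min mu w : antidominant mu ->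
  (N (transl mu) <= N (transl mu * of_weyl w)%g)%N.
Proof.
move=> amu; rewrite N_transl N_sum -(perm_big _ (perm_roots_weyl w)) big_map.
rewrite !big_seq; apply: leq_sum => a; rewrite mem_undup => Ra.
rewrite mul_weyl /= mul1mx mul0mx addr0.
have Rwa := weyl_roots w Ra.
case cw: (chi D (w *m a)) => [|n].
  have le0 := antidominant_pos amu Rwa cw.
  have -> : Num.truncn (pairing mu (weyl_mx w *m a)) = 0%N; last exact: leq0n.
  by apply/eqP; rewrite -leqn0 truncn_le_nat; lra.
apply: le_truncn; rewrite -addrA lerDl subr_ge0 ler_nat.
by rewrite /chi; case: (_ < 0).
Qed.

End InversionCount.

Section Stabiliser.
Variables (r : nat) (D : root_system r).
Implicit Types (x y : extaff D) (l mu : coweight D) (w : weyl D) (a v : 'cV[rat]_r).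

Lemma of_weylM w w' : of_weyl (w * w')%g = (of_weyl w * of_weyl w')%g.
Proof. by apply: extaff_ext; rewrite /= ?mul0mx ?addr0. Qed.

Lemma of_weyl_simple j : of_weyl (wrefl (alpha_root D j)) = aff_refl D (lift ord0 j).
Proof. by rewrite /aff_refl liftK. Qed.

(** Some affine simple root becomes negative. It is not [alpha_0], whose image
  has the null root in it with coefficient 1. *)
Lemma of_weyl_descent w : w != 1%g ->
  exists j, ~~ apos D (aff_act (of_weyl w) (aff_alpha D (lift ord0 j))).
Proof.
move=> w1; have [u uE] := is_word_of_weyl w.
have N0 : N (of_weyl w) != 0%N.
  apply: contra w1 => /eqP; rewrite uE => /word_N0; rewrite -uE.
  by move/(congr1 (@weyl_part _ _)) => /= ->.
have [i] := ex_descent N0; case: (unliftP ord0 i) => [j|] ->; first by exists j.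
have := aff_act_aroot (of_weyl w) (asimple_aroot D ord0).
rewrite asimple0 /aff_act /= pairing0l subr0 => Ra.
by rewrite aposE // /chi; case: (_ < 0).
Qed.

Lemma chi_alpha j : chi D (alpha D j) = 0%N.
Proof.
have := asimple_apos D (lift ord0 j); have := asimple_aroot D (lift ord0 j).
by rewrite asimple_lift => Rj; rewrite aposE // lern0 => /eqP.
Qed.

Lemma apos_weyl_alpha w j :
  apos D (aff_act (of_weyl w) (aff_alpha D (lift ord0 j)))
    = (chi D (weyl_mx w *m alpha D j) == 0%N).
Proof.
have := aff_act_aroot (of_weyl w) (asimple_aroot D (lift ord0 j)).
rewrite asimple_lift /aff_act /= pairing0l subr0 => Ra.
by rewrite aposE // lern0.
Qed.

Lemma wact_refl l j : pairing l (alpha D j) = 0 -> wact (wrefl (alpha_root D j)) l = l.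
Proof.
move=> l0; apply: val_inj; apply: pairing_ext => v.
have E := @pairing_wact _ _ (wrefl (alpha_root D j)) l (refl_mx D (alpha D j) *m v).
rewrite /= mulmxA refl_mxK ?alpha_root // mul1mx in E; rewrite E.
by rewrite refl_mxE !pairingE l0 mulr0 subr0.
Qed.

(** This gives both that an orbit has a single antidominant point and that its
  stabiliser is generated by simple reflections. Strip a simple reflection [s_j]
  off the right of [w]: antidominance of [w mu] at the negative root [w alpha_j]
  and that of [mu] at [alpha_j] force [s_j] to fix [mu]. *)
Lemma antidominant_parabolic mu w : antidominant mu -> antidominant (wact w mu) ->
  w \in parabolic mu.
Proof.
move=> amu; have [n] := ubnP (N (of_weyl w)); elim: n w => // n IH w; rewrite ltnS => Nw aw.
have [->|w1] := eqVneq w 1%g; first exact: group1.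
have [j nj] := of_weyl_descent w1.
pose s := wrefl (alpha_root D j).
have mu0 : pairing mu (alpha D j) = 0.
  apply/eqP; rewrite eq_le amu /= -(pairing_wact w).
  apply: antidominant_neg => //; first by rewrite weyl_roots ?alpha_root.
  by move: nj; rewrite apos_weyl_alpha /chi; case: (_ < 0).
have ss : (s * s)%g = 1%g by apply: val_inj; rewrite /= refl_mxK ?alpha_root.
have sP : s \in parabolic mu by apply: mem_gen; apply/imsetP; exists j; rewrite ?inE ?mu0.
have -> : w = (w * s * s)%g by rewrite -mulgA ss mulg1.
apply: groupM sP; apply: IH; last by rewrite wactM wact_refl.
by move: Nw; rewrite (N_mulrV nj) of_weylM of_weyl_simple.
Qed.

Lemma parabolic_stab mu : antidominant mu -> parabolic mu = [set w | wact w mu == mu].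
Proof.
move=> amu; apply/eqP; rewrite eqEsubset; apply/andP; split; last first.
  by apply/subsetP => w; rewrite inE => /eqP E; apply: antidominant_parabolic; rewrite ?E.
have gS : group_set [set w | wact w mu == mu].
  apply/group_setP; split=> [|u w]; rewrite !inE ?wact1 // => /eqP uE /eqP wE.
  by rewrite wactM wE uE.
suff : parabolic mu \subset Group gS by [].
rewrite gen_subG; apply/subsetP => w /imsetP[j]; rewrite !inE => /eqP mu0 ->.
by rewrite wact_refl.
Qed.

End Stabiliser.

(** * Cancellation over a Weyl orbit of translations *)

Section TranslationSum.
Variables (r : nat) (D : root_system r) (Q : nzRingType) (qc : rat -> Q).
Hypothesis qcN : forall c, qc (- c) = - qc c.
Variables (g : extaff D -> Q) (v : 'cV[rat]_r).
Implicit Types (l mu : coweight D) (w : weyl D) (a : 'cV[rat]_r).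
Local Notation R := (undup (roots D)).

(** The part of the correction terms for [t_l] that comes from the inversions
  with finite part [a]. *)
Definition refl_sum l a : Q :=
  \sum_(k <- iota 0 (Num.truncn (pairing l a)))
    qc (pairing (coroot D a) v) * g (transl l * arefl (a, (chi D a)%:R + k%:R))%g.

Lemma inversions_transl_sum l :
  \sum_(b <- inversions (transl l)) qc (pairing (coroot D b.1) v) * g (transl l * arefl b)%g
  = \sum_(a <- R) refl_sum l a.
Proof.
rewrite big_allpairs_dep; apply: eq_bigr => a _.
by rewrite /= mul1mx addrK.
Qed.

(** With [m = <l, a>], the elements [t_l s_(a, n)] for
  [chi a <= n < chi a + m] are, in the opposite order, the elements
  [t_(s_a l) s_(- a, n')] for [chi (- a) <= n' < chi (- a) + m]. *)
Lemma transl_arefl_opp l a (Ra : a \in roots D) (m k : nat) :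
  pairing l a = m%:R -> (k < m)%N ->
  (transl (wact (wrefl Ra) l) * arefl (- a, (chi D (- a))%:R + (m - k.+1)%:R) =
   transl l * arefl (a, (chi D a)%:R + k%:R))%g.
Proof.
move=> la km.
have Rb : is_aroot D (a, (chi D a)%:R + k%:R) by rewrite /is_aroot Ra rpredD ?rpred_nat.
have Rb' : is_aroot D (- a, (chi D (- a))%:R + (m - k.+1)%:R).
  by rewrite /is_aroot root_opp // rpredD ?rpred_nat.
apply: extaff_ext; last by rewrite !mul_weyl !arefl_weyl //= refl_opp.
rewrite !mul_trans !arefl_trans //= invmx1 !mulmx1 coroot_opp // scalerN scaleNr opprK.
have -> : (l : 'rV[rat]_r) *m invmx (refl_mx D a) = (l : 'rV[rat]_r) - m%:R *: coroot D a.
  apply: pairing_ext => x; rewrite pairingM.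
  have -> : invmx (refl_mx D a) = refl_mx D a.
    by rewrite -[LHS]mul1mx -(refl_mxK Ra) mulmxK // (weyl_unit (wrefl Ra)).
  by rewrite refl_mxE !pairingE la; ring.
rewrite -addrA -!scaleNr -scalerDl; congr (_ + _ *: _).
have c1 : (chi D a <= 1)%N by rewrite /chi; case: (_ < 0).
by rewrite chi_opp // !natrB // -[k.+1%:R]natr1; ring.
Qed.

Lemma refl_sum_opp l a (Ra : a \in roots D) :
  refl_sum (wact (wrefl Ra) l) (- a) = - refl_sum l a.
Proof.
have E : pairing (wact (wrefl Ra) l) (- a) = pairing l a.
  have <- : weyl_mx (wrefl Ra) *m a = - a.
    by rewrite /= refl_mxE coroot_root // scaler_nat mulr2n opprD addNKr.
  exact: pairing_wact.
rewrite /refl_sum E coroot_opp // pairingNl qcN -sumrN.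
set m := Num.truncn _; rewrite -[m]subn0 -/(index_iota 0 m) big_nat_rev /=.
rewrite big_nat_cond [RHS]big_nat_cond; apply: eq_bigr => k; rewrite andbT => /= km.
have la : pairing l a = m%:R.
  have m0 : (0 < m)%N by exact: leq_ltn_trans km.
  rewrite /m truncnK //; rewrite truncn_gt0 in m0.
  by rewrite natrEint coweight_int // (le_trans _ m0).
by rewrite mulNr add0n transl_arefl_opp.
Qed.

(** The pairs [(l, a)] and [(s_a l, - a)] contribute the same group elements with
  opposite coefficients. *)
Lemma orbit_sum_opp mu :
  let S := \sum_(w : weyl D) \sum_(a <- R) refl_sum (wact w mu) a in
  S = - S.
Proof.
move=> S; rewrite {1}/S exchange_big /= -(perm_big _ (perm_roots_opp D)) big_map.
rewrite /S -sumrN; under [RHS]eq_bigr => w _ do rewrite -sumrN.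
rewrite [RHS]exchange_big /= !big_seq; apply: eq_bigr => a; rewrite mem_undup => Ra.
rewrite (reindex_inj (mulgI (wrefl Ra))) /=; apply: eq_bigr => w _.
by rewrite wactM refl_sum_opp.
Qed.

End TranslationSum.

(** * The elements of the extended nil-Hecke ring *)

Section DemazureElements.
Variables (r : nat) (D : root_system r).
Local Notation Q := (Qaff D).
Implicit Types (x y t : extaff D) (w : weyl D) (v : 'cV[rat]_r) (u : seq 'I_r.+1).
Implicit Types (g h : Q).
Local Notation val u := (word_prod D u).
Local Notation e0 := (stab_sum D 0).

Lemma Agen_word u : Aw (Agen D) u = word_value (Agen D) (size u) (val u).
Proof.
exact: (Aw_word_value (@Agen_qlin r D) (@qcst_comm r D) (@Agen_sqr r D)
  (@Agen_stab_sum r D) (@intertwiner_stab_sum r D)).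
Qed.

(** Some reduced word ends with any given right descent. *)
Lemma Adem_descent x i : is_word x -> ~~ apos D (aff_act x (aff_alpha D i)) ->
  exists g, Adem x = g * Agen D i.
Proof.
move=> [u ->] /N_mulrV Ni.
have [vE Sv] := redwordP D (rcons u i); set z := redword _ in vE Sv.
have E : val (rcons z i) = val u.
  by rewrite word_prod_rcons vE word_prod_rcons -mulgA aff_refl_sqr mulg1.
exists (Aw (Agen D) z); rewrite -Aw_rcons Agen_word E size_rcons Sv.
by rewrite word_prod_rcons -Ni /word_value eqxx.
Qed.

Lemma kill_right (K : nzRingType) (a b c d : K) : a = b * c -> c * d = 0 -> a * d = 0.
Proof. by move=> -> cd; rewrite -mulrA cd mulr0. Qed.

Lemma fixes_origin j : fixes_point D 0 (lift ord0 j).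
Proof. by rewrite fixes_point_lift pairing0l. Qed.

Lemma Adem_kill x j : is_word x -> ~~ apos D (aff_act x (aff_alpha D (lift ord0 j))) ->
  Adem x * e0 = 0.
Proof.
move=> Wx nx; have [g gE] := Adem_descent Wx nx.
exact: kill_right gE (Agen_stab_sum (fixes_origin j)).
Qed.

Lemma kill_sum (K : nzRingType) (I : finType) (P : pred I) (b c : I -> K) (a e : K) :
  a = \sum_(i | P i) b i * c i -> (forall i, P i -> c i * e = 0) -> a * e = 0.
Proof.
move=> -> ce; rewrite mulr_suml big1 // => i Pi.
by rewrite -mulrA ce // mulr0.
Qed.

Lemma in_ideal_kill g : in_ideal g -> g * e0 = 0.
Proof.
move=> [b [_ gE]]; apply: kill_sum gE _ => w w1.
have [j nj] := of_weyl_descent w1.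
exact: Adem_kill (is_word_of_weyl w) nj.
Qed.

(** This is the case [w = 1] and [nu = 0] of the statement on intertwiners.
  Together with the previous lemma, it shows that the centraliser meets the left
  ideal generated by the [A_y], [y] in [W - 1], trivially. *)
Lemma central_kill g :
  (forall a, a \in roots D -> g * qlin D a = qlin D a * g) -> g * e0 = 0 -> g = 0.
Proof.
move=> gc; apply: (intertwiner_stab_sum (w := 1%g)) => a Ra.
by rewrite /= mul1mx; exact: gc.
Qed.

Lemma root_symP a : a \in roots D -> exists s : symP D, Sscal s = qlin D a.
Proof.
move=> Ra; have S : symP_pred D (linform a).
  by apply/asboolP/symP_weight => b Rb; exact: roots_integral.
by exists (SymP S).
Qed.

End DemazureElements.

(** * Decompositions and lengths in the extended group *)

Section Decomposition.
Variables (r : nat) (D : root_system r) (H : grassmannian_homology D).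
Implicit Types (x y t : extaff D).

Lemma in_Z1 : in_Z (1%g : extaff D).
Proof. by apply/in_ZP => b; rewrite aff_act1. Qed.

Lemma in_Waff1 : in_Waff (1%g : extaff D).
Proof. by exists (fun=> 0); rewrite big1. Qed.

Lemma len1 x : hat x = 1%g -> len x = 0%N.
Proof.
move=> h1; rewrite /len h1; have [_] := redwordP D [::].
have -> : word_prod D [::] = 1%g by rewrite /word_prod big_nil.
by move=> ->; exact/N_in_Z/in_Z1.
Qed.

Lemma diff_kill (K : nzRingType) (a b c e : K) :
  (a - c) * e = 0 -> (b - c) * e = 0 -> (a - b) * e = 0.
Proof.
move=> ac bc; have -> : a - b = (a - c) - (b - c) by rewrite opprB addrA subrK.
by rewrite mulrBl ac bc subrr.
Qed.

Lemma diff_comm (K : nzRingType) (a b q : K) :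
  a * q = q * a -> b * q = q * b -> (a - b) * q = q * (a - b).
Proof. by move=> ha hb; rewrite mulrBl mulrBr ha hb. Qed.

Lemma jad_comm h (a : 'cV[rat]_r) : a \in roots D -> jad H h * qlin D a = qlin D a * jad H h.
Proof.
move=> /root_symP[s <-]; have [_] : in_ZAaff (jad H h) by apply/jad_image; exists h.
exact.
Qed.

Lemma jad_schubert_eq x y : minrep x -> minrep y -> Atil x = Atil y ->
  schubert H x = schubert H y.
Proof.
move=> mx my E; apply: (@jad_inj _ _ H); apply/eqP; rewrite -subr_eq0; apply/eqP.
apply: central_kill => [a Ra|]; first by apply: diff_comm; exact: jad_comm.
apply: (@diff_kill _ _ _ (Atil x)); apply: in_ideal_kill; first exact: jad_schubert.
by rewrite E; exact: jad_schubert.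
Qed.

Lemma malgU1_inj (K : choiceType) (A : nzRingType) (k k' : K) :
  << 1 *g k >> = << 1 *g k' >> :> {malg A[K]} -> k = k'.
Proof.
move/(congr1 (monalg.mcoeff k)); rewrite !mcoeffU eqxx.
by case: eqP => // _ /eqP; rewrite oner_eq0.
Qed.

Lemma schubert_inj x y : minrep x -> minrep y -> schubert H x = schubert H y -> x = y.
Proof.
move=> mx my E; have [c [_ cU]] := schubert_basis (schubert H x).
have delta_ok z : minrep z -> schubert H z = schubert H x ->
    c = << 1 *g z >> :> {malg symP D[extaff D]}.
  move=> mz zE; apply: cU.
  have dom : monalg.msupp (<< 1 *g z >> : {malg symP D[extaff D]}) = [fset z]%fset.
    by rewrite msuppU oner_eq0.
  split=> [w|].
    by rewrite dom in_fset1 => /eqP ->; exact: mz.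
  by rewrite dom big_seq_fset1 mcoeffUU scale1r; exact: esym zE.
exact: malgU1_inj (etrans (esym (delta_ok x mx erefl)) (delta_ok y my (esym E))).
Qed.

(** If the roots are listed with repetitions, the integral combinations of the
  listed coroots can form too small a lattice for decompositions to exist. An
  element without one has, by the default values, length zero and the same
  [A~] as [1], so that its Schubert class coincides with that of [1]; this
  cannot happen in a basis. *)
Lemma Z_Waff_decomposition x :
  exists t y, [/\ in_Z t, in_Waff y & x = (t * y)%g].
Proof.
have [//|none] := pselect (exists t y, [/\ in_Z t, in_Waff y & x = (t * y)%g]).
have Zx : Zdecomp x = (1%g, 1%g).
  rewrite /Zdecomp; case: classical_sets.xgetP => // -[t y] _ [/= tZ Wy E].
  by case: none; exists t, y.
have Z1 : Zdecomp (1%g : extaff D) = (1%g, 1%g).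
  rewrite /Zdecomp; case: classical_sets.xgetP => // -[t y] _ [/= tZ /in_Waff_word Wy E].
  have [] := Zdecomp_uniq tZ in_Z1 Wy (is_word1 D); last by move=> -> ->.
  by rewrite mulg1.
have minr (z : extaff D) : hat z = 1%g -> minrep z by move=> h w; rewrite (len1 h).
have hx : hat x = 1%g by rewrite /hat Zx.
have h1 : hat (1%g : extaff D) = 1%g by rewrite /hat Z1.
have : x = 1%g.
  apply: schubert_inj (minr _ hx) (minr _ h1) _; apply: jad_schubert_eq (minr _ hx) (minr _ h1) _.
  by rewrite /Atil /Zpart /hat Zx Z1.
move=> x1; case: none; exists 1%g, 1%g; split; rewrite ?mulg1 //.
  exact: in_Z1.
exact: in_Waff1.
Qed.

Lemma word_in_Waff u : in_Waff (word_prod D u).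
Proof.
have [t [y [tZ Wy E]]] := Z_Waff_decomposition (word_prod D u).
have [] := Zdecomp_uniq in_Z1 tZ (ex_intro _ u erefl) (in_Waff_word Wy).
  by rewrite mul1g.
by move=> _ ->.
Qed.

Lemma Zdecomp_word t u : in_Z t -> Zdecomp (t * word_prod D u)%g = (t, word_prod D u).
Proof.
move=> tZ; rewrite /Zdecomp; case: classical_sets.xgetP => [[t' y] _ [/= tZ' Wy E]|].
  by have [-> ->] := Zdecomp_uniq tZ tZ' (ex_intro _ u erefl) (in_Waff_word Wy) E.
by move=> /(_ (t, word_prod D u)) []; split=> //; exact: word_in_Waff.
Qed.

Lemma Atil_word t u : in_Z t -> Atil (t * word_prod D u)%g = delta t * Adem (word_prod D u).
Proof. by move=> tZ; rewrite /Atil /Zpart /hat Zdecomp_word. Qed.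

Lemma len_N x : len x = N x.
Proof.
have [t [u [tZ -> _]]] := Z_word x.
rewrite /len /hat Zdecomp_word //= N_in_Zl //.
by case: (redwordP D u).
Qed.

(** The analogue of [word_value] in the extended ring. *)
Definition Atil_value n x : Qaff D := if N x == n then Atil x else 0.

Lemma delta_Aw t u : in_Z t ->
  delta t * Aw (Agen D) u = Atil_value (size u) (t * word_prod D u)%g.
Proof.
move=> tZ; rewrite Agen_word /Atil_value /word_value N_in_Zl //; case: ifP => _.
  exact: esym (Atil_word u tZ).
exact: mulr0.
Qed.

(** The Kostant-Kumar commutation formula: the correction terms run over the
  reflections that lower the length by exactly one. *)
Lemma Atil_qlin x v : Atil x * qlin D v =
  qlin D (weyl_mx (weyl_part x) *m v) * Atil x +
  \sum_(b <- inversions x)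
    qcst D (pairing (coroot D b.1) v) * Atil_value (N x).-1 (x * arefl b)%g.
Proof.
have [t [u [tZ xE Su]]] := Z_word x; rewrite xE in Su *.
have AE : Atil (t * word_prod D u)%g = delta t * Aw (Agen D) u.
  by apply: etrans (esym (delta_Aw u tZ)); rewrite Su /Atil_value eqxx.
have tw := @Aw_ql_twist _ D _ _ _ _ (@Agen_qlin r D) (@qcst_comm r D) t (delta t)
  u v (delta_qlin t).
apply: etrans (congr1 (fun g => g * qlin D v) AE) _; apply: etrans tw _.
apply: f_equal2 (f_equal2 GRing.mul erefl (esym AE)) _.
have P : perm_eq (inversions (t * word_prod D u)%g) (map fst (dels D u)).
  apply: perm_trans (perm_inversions_Z _ tZ) (perm_dels _).
  by rewrite Su N_in_Zl.
rewrite [RHS](perm_big _ P) [RHS]big_map [LHS]big_seq [RHS]big_seq; apply: eq_bigr => q /delsP[_ Sq E].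
apply: f_equal2 erefl _; apply: etrans (delta_Aw _ tZ) _.
by rewrite E mulgA -Su -Sq.
Qed.

End Decomposition.

(** * The sum over the orbit of an antidominant coweight *)

Section TorsionFree.
Variables (r : nat) (D : root_system r).

Lemma tofrac_natr_neq0 n : (n.+1%:R : {fraction (mpoly.mpoly r rat)}) != 0.
Proof.
rewrite -(rmorph_nat (@FracField.tofrac _)) tofrac_eq0.
by rewrite -(rmorph_nat (@mpolyC r rat)) mpolyC_eq0 pnatr_eq0.
Qed.

Lemma idomain_torsion (K : idomainType) (f : K) n : n.+1%:R != 0 :> K ->
  f *+ n.+1 = 0 -> f = 0.
Proof. by move=> nz /eqP; rewrite -mulr_natr mulf_eq0 (negbTE nz) orbF => /eqP. Qed.

Lemma Qaff_torsion (g : Qaff D) n : g *+ n.+1 = 0 -> g = 0.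
Proof.
move=> gn; apply: Qext => x; rewrite cf0; apply: (idomain_torsion (@tofrac_natr_neq0 n)).
have := congr1 (fun h => cf h x) gn; rewrite cf0 => <-.
exact: esym (raddfMn (monalg.mcoeff x) n.+1 g).
Qed.

End TorsionFree.

Section RingIdentities.
Variables (K : nzRingType).
Hypothesis torsion : forall (g : K) n, g *+ n.+1 = 0 -> g = 0.

Lemma eq_opp0 (g : K) : g = - g -> g = 0.
Proof. by move=> E; apply: (torsion (n := 1)); rewrite mulr2n {2}E subrr. Qed.

Lemma sum_comm (I : finType) (f h : I -> K) q :
  (forall i, f i * q = q * f i + h i) -> \sum_i h i = 0 ->
  (\sum_i f i) * q = q * (\sum_i f i).
Proof.
move=> fq h0; rewrite mulr_suml (eq_bigr _ (fun i _ => fq i)) big_split /= h0 addr0.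
by rewrite mulr_sumr.
Qed.

Lemma comm_divn (a b q : K) n : b = a *+ n.+1 -> b * q = q * b -> a * q = q * a.
Proof.
move=> bE bq; apply/eqP; rewrite -subr_eq0; apply/eqP; apply: (@torsion _ n).
by rewrite mulrnBl -mulrnAl -mulrnAr -bE bq subrr.
Qed.

Lemma sum_kill_but (I : finType) (A : {set I}) (f : I -> K) i0 e : i0 \in A ->
  (forall i, i \in A -> i != i0 -> f i * e = 0) -> (\sum_(i in A) f i) * e = f i0 * e.
Proof.
move=> Ai0 f0; rewrite mulr_suml (bigD1 i0) //= big1 ?addr0 // => i /andP[Ai ii0].
exact: f0.
Qed.

End RingIdentities.

Section OrbitSum.
Variables (r : nat) (D : root_system r) (H : grassmannian_homology D).
Implicit Types (l mu : coweight D) (w : weyl D) (v : 'cV[rat]_r).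

Lemma Atil_transl_qlin l v : Atil (transl l) * qlin D v = qlin D v * Atil (transl l) +
  \sum_(a <- undup (roots D)) refl_sum (@qcst r D) (Atil_value (N (transl l)).-1) v l a.
Proof.
have := Atil_qlin H (transl l) v; rewrite mul1mx => E; apply: etrans E _.
apply: f_equal2 erefl _; exact: inversions_transl_sum.
Qed.

(** All the translations of the orbit have the same length, so that their
  correction terms involve the same elements and cancel. *)
Lemma orbit_sum_comm mu v :
  (\sum_(w : weyl D) Atil (transl (wact w mu))) * qlin D v =
  qlin D v * \sum_(w : weyl D) Atil (transl (wact w mu)).
Proof.
apply: sum_comm => [w|]; first exact: Atil_transl_qlin.
apply: (eq_opp0 (@Qaff_torsion r D)).
have E := orbit_sum_opp (@qcstN r D) (Atil_value (N (transl mu)).-1) v mu.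
suff S : \sum_(w : weyl D) \sum_(a <- undup (roots D))
    refl_sum (@qcst r D) (Atil_value (N (transl (wact w mu))).-1) v (wact w mu) a =
  \sum_(w : weyl D) \sum_(a <- undup (roots D))
    refl_sum (@qcst r D) (Atil_value (N (transl mu)).-1) v (wact w mu) a.
  by rewrite S; exact: E.
by apply: eq_bigr => w _; apply: eq_bigr => a _; rewrite N_transl_wact.
Qed.

Lemma lcoset_sum (G : zmodType) mu (f : coweight D -> G) :
  parabolic mu = [set w | wact w mu == mu] ->
  \sum_(w : weyl D) f (wact w mu) =
  (\sum_(C in lcosets (parabolic mu) [set: weyl D]) f (wact (repr C) mu))
    *+ #|parabolic mu|.
Proof.
move=> PE; rewrite (partition_big (fun w => w *: parabolic mu)%g
  (mem (lcosets (parabolic mu) [set: weyl D]))) /= => [|w _]; last first.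
  by apply/lcosetsP; exists w; rewrite ?inE.
rewrite -sumrMnl; apply: eq_bigr => C /lcosetsP[w0 _ ->].
rewrite (eq_bigr (fun=> f (wact (repr (w0 *: parabolic mu)%g) mu))) => [|w /eqP E].
  rewrite sumr_const; congr (_ *+ _).
  rewrite -(card_lcoset (parabolic mu) w0); apply: eq_card => w.
  by rewrite -[LHS]/(w *: _ == w0 *: _)%g; apply/eqP/idP => [<-|/lcoset_eqP];
    rewrite ?lcoset_refl //.
have : repr (w0 *: parabolic mu)%g \in (w *: parabolic mu)%g.
  by rewrite E; apply: (mem_repr w0); exact: lcoset_refl.
case/lcosetP=> p; rewrite {1}PE inE => /eqP pm ->.
by rewrite wactM pm.
Qed.

Lemma coset_sum_comm mu v : parabolic mu = [set w | wact w mu == mu] ->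
  (\sum_(C in lcosets (parabolic mu) [set: weyl D])
     Atil (transl (wact (repr C) mu))) * qlin D v =
  qlin D v * \sum_(C in lcosets (parabolic mu) [set: weyl D])
    Atil (transl (wact (repr C) mu)).
Proof.
move=> PE; have := lcoset_sum (fun l => Atil (transl l)) PE.
have /prednK <- := cardG_gt0 (parabolic mu).
by move/(comm_divn (@Qaff_torsion r D)); apply; exact: orbit_sum_comm.
Qed.

(** [A~_x] ends with the factor [A_j]. *)
Lemma Atil_kill x j : ~~ apos D (aff_act x (aff_alpha D (lift ord0 j))) ->
  Atil x * stab_sum D 0 = 0.
Proof.
have [t [u [tZ -> _]]] := Z_word x; rewrite aff_actM in_Z_apos // => nx.
exact: kill_right (Atil_word H u tZ) (Adem_kill (ex_intro _ u erefl) nx).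
Qed.

Lemma Atil_transl_kill l : ~ antidominant l -> Atil (transl l) * stab_sum D 0 = 0.
Proof.
move=> na; have [j pj] : exists j, 0 < pairing l (alpha D j).
  apply/existsP; apply: contra_notT na; rewrite negb_exists => /forallP h j.
  by rewrite leNgt; exact: h.
apply: (Atil_kill (j := j)).
have := aff_act_aroot (transl l) (asimple_aroot D (lift ord0 j)).
rewrite asimple_lift /aff_act /= mul1mx => Ra.
by rewrite aposE // chi_alpha sub0r -ltNge oppr_lt0.
Qed.

Lemma minrep_transl mu : antidominant mu -> minrep (transl mu).
Proof. by move=> amu w; rewrite !(len_N H) N_transl_min. Qed.

Lemma parabolic_coset mu : parabolic mu \in lcosets (parabolic mu) [set: weyl D].
Proof. by apply/lcosetsP; exists 1%g; rewrite ?inE ?mul1g ?lcoset1. Qed.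

Lemma coset_sum_kill mu : antidominant mu ->
  (\sum_(C in lcosets (parabolic mu) [set: weyl D])
     Atil (transl (wact (repr C) mu))) * stab_sum D 0 = Atil (transl mu) * stab_sum D 0.
Proof.
move=> amu; have PE := parabolic_stab amu.
apply: etrans (sum_kill_but (parabolic_coset mu) _) _ => [C /lcosetsP[w _ CE] CP|].
  apply: Atil_transl_kill => ar; case/eqP: CP.
  have rC : repr C \in C by rewrite CE; apply: (mem_repr w); exact: lcoset_refl.
  have := antidominant_parabolic amu ar.
  rewrite {2}CE in rC; have /lcoset_eqP E := rC.
  by move=> rP; rewrite [LHS]CE -E; exact: lcoset_id.
have : repr (parabolic mu) \in parabolic mu by apply: (mem_repr 1%g); exact: group1.
by rewrite {2}PE inE => /eqP ->.
Qed.

End OrbitSum.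

Theorem proposition1p2 (r : nat) (D : root_system r)
    (H : grassmannian_homology D) (mu : coweight D) (hmu : antidominant mu) :
  parabolic mu = [set w : weyl D | wact w mu == mu] /\
  jad H (schubert H (transl mu)) =
    \sum_(C in lcosets (parabolic mu) [set: weyl D])
      Atil (transl (wact (repr C) mu)).
Proof.
have PE := parabolic_stab hmu; split=> //.
apply/eqP; rewrite -subr_eq0; apply/eqP; apply: central_kill => [a Ra|].
  by apply: diff_comm; [exact: jad_comm | exact: coset_sum_comm].
apply: (@diff_kill _ _ _ (Atil (transl mu))).
  by apply: in_ideal_kill; apply: jad_schubert; exact: minrep_transl.
rewrite mulrBl; apply/eqP; rewrite subr_eq0; apply/eqP; exact: coset_sum_kill.
Qed.
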